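(* Let $r,n\ge1$. The maps $\mathsf{M}_{V\to O}$ and $\mathsf{M}_{V\to F}$, from the set of $(2r+1)$-orthogonal vacillating tableaux of weight zero and length $n$ to the set of $n\times n$ matrices with nonnegative integer entries, are injective.
   Context: Partitions with at most $r$ parts are identified with weakly decreasing $r$-tuples of nonnegative integers; $\emptyset=(0,\dots,0)$, $\mathbf{e}_i$ is the $i$-th unit vector, $\mathbf{1}=(1,\dots,1)$. For $x\in\mathbb{Z}^r$, $\mathrm{dom}(x)$ is obtained by sorting $|x_1|,\dots,|x_r|$ into weakly decreasing order. A $(2r+1)$-orthogonal vacillating tableau of length $n$ and weight zero is a sequence $\mathsf{V}=(\emptyset=\lambda^0,\dots,\lambda^n=\emptyset)$ of partitions with at most $r$ parts such that consecutive partitions are equal or differ by exactly one box, and if two consecutive partitions are equal then all their $r$ parts are positive. $\iota_{V\to O}(\mathsf{V})=(\mu^0,\dots,\mu^{2n})$ with $\mu^{2i}=2\lambda^i$, $\mu^{2i-1}=\lambda^{i-1}+\lambda^i$ if $\lambda^{i-1}\ne\lambda^i$, $\mu^{2i-1}=2\lambda^i-\mathbf{e}_r$ if $\lambda^{i-1}=\lambda^i$. $\iota_{V\to F}(\mathsf{V})=(\mu^0,\dots,\mu^{2n})$ with $\mu^{2i}=2\lambda^i$ and $\mu^{2i-1}=2\lambda^{i-1}+\mathbf{1}$ if $\lambda^i$ is $\lambda^{i-1}$ plus a box, $2\lambda^i+\mathbf{1}$ if $\lambda^{i-1}$ is $\lambda^i$ plus a box, $2\lambda^{i-1}+\mathbf{1}-2\mathbf{e}_r$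 if $\lambda^{i-1}=\lambda^i$. For $X\in\{O,F\}$: one promotion step takes $(\mu^0,\dots,\mu^{2n})$ to $(\hat\mu^0,\dots,\hat\mu^{2n})$: put $a_2=\mu^1$, $a_c=\mathrm{dom}(a_{c-1}+\mu^c-\mu^{c-1})$, $b_2=\emptyset$, $b_c=\mathrm{dom}(b_{c-1}+a_c-a_{c-1})$ for $3\le c\le 2n$; $\hat\mu^{c-2}=b_c$ for $2\le c\le 2n$, $\hat\mu^{2n-1}=a_{2n}$, $\hat\mu^{2n}=\emptyset$. For $3\le c\le 2n$ the cells in column $c$ are filled with $\Phi_X(a_{c-1}+\mu^c-\mu^{c-1})$ (row 1) and $\Phi_X(b_{c-1}+a_c-a_{c-1})$ (row 2), where $\Phi_F(x)$ is the number of negative entries of $x$, and $\Phi_O(x)=1$ if $x$ has a negative entry and $0$ otherwise. Starting from $\iota_{V\to X}(\mathsf{V})$ perform $n$ steps successively. $\mathsf{M}_{V\to X}(\mathsf{V})=(m_{i,j})_{1\le i,j\le n}$ has $m_{i,i}=0$, and for $1\le i\le n$, $2\le k\le n$, $j\equiv i+k-1\pmod n$, $m_{i,j}$ is the sum of the four fillings of cells in rows 1, 2 and columns $2k-1,2k$ of the $i$-th step. *)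

(* Defs.v *)
From mathcomp Require Import all_boot all_order all_algebra.

Set Implicit Arguments.
Unset Strict Implicit.
Unset Printing Implicit Defensive.

Import Order.TTheory GRing.Theory Num.Theory.
Local Open Scope ring_scope.

Section Weights.
Variable r : nat.
Implicit Types x y lam mu : 'rV[int]_r.

Definition unit_vec (i : 'I_r) : 'rV[int]_r := delta_mx 0 i.

(* e_r; the case r = 0, where this is the empty vector, is never used. *)
Definition last_unit : 'rV[int]_r := \row_(j < r) (j.+1 == r)%:R.

Definition is_partition x : bool :=
  [forall i, 0 <= x 0 i] &&
  [forall i : 'I_r, forall j : 'I_r, (i <= j)%N ==> (x 0 j <= x 0 i)].

Definition adds_box lam mu : bool := [exists i, mu == lam + unit_vec i].

Definition dom x : 'rV[int]_r :=
  \row_(i < r) nth 0 (sort >=%R [seq `|x 0 j| | j <- enum 'I_r]) i.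

Definition Phi_F x : nat := #|[set i | x 0 i < 0]|.
Definition Phi_O x : nat := [exists i, x 0 i < 0].

Definition vacillating_step lam mu : bool :=
  [|| adds_box lam mu, adds_box mu lam |
      (lam == mu) && [forall i, 0 < lam 0 i]].

Definition vacillating_tableau (n : nat) : pred (n.+1.-tuple 'rV[int]_r) :=
  fun V =>
  [&& nth 0 V 0%N == 0, nth 0 V n == 0, all is_partition V &
      [forall i : 'I_n, vacillating_step (nth 0 V i) (nth 0 V i.+1)]].

(* Sequences (mu^0, ..., mu^{2n}) are functions on nat of which only the values
   at 0, ..., 2n matter.  In the two maps below, uphalf d is the index i with
   d = 2i or d = 2i - 1. *)
Definition iota_VO (n : nat) (V : n.+1.-tuple 'rV[int]_r) (d : nat) :
    'rV[int]_r :=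
  let cur := nth 0 V (uphalf d) in
  let prev := nth 0 V (uphalf d).-1 in
  if ~~ odd d then cur *+ 2
  else if prev == cur then cur *+ 2 - last_unit
  else prev + cur.

Definition iota_VF (n : nat) (V : n.+1.-tuple 'rV[int]_r) (d : nat) :
    'rV[int]_r :=
  let cur := nth 0 V (uphalf d) in
  let prev := nth 0 V (uphalf d).-1 in
  if ~~ odd d then cur *+ 2
  else if prev == cur then prev *+ 2 + const_mx 1 - last_unit *+ 2
  else if adds_box prev cur then prev *+ 2 + const_mx 1
  else cur *+ 2 + const_mx 1.

(* A row of the growth diagram below the row nu: it starts with x0 in column 2
   (also the junk value in columns 0 and 1) and satisfies
   z_c = dom (z_{c-1} + nu_c - nu_{c-1}) for c >= 3. *)
Fixpoint growth_row (x0 : 'rV[int]_r) (nu : nat -> 'rV[int]_r) (c : nat) :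
    'rV[int]_r :=
  if c is c'.+1 then
    if (2 <= c')%N then dom (growth_row x0 nu c' + nu c - nu c') else x0
  else x0.

Definition row_a (mu : nat -> 'rV[int]_r) : nat -> 'rV[int]_r :=
  growth_row (mu 1%N) mu.
Definition row_b (mu : nat -> 'rV[int]_r) : nat -> 'rV[int]_r :=
  growth_row 0 (row_a mu).

Definition promotion (n : nat) (mu : nat -> 'rV[int]_r) (d : nat) :
    'rV[int]_r :=
  if (d.+2 <= 2 * n)%N then row_b mu d.+2
  else if d.+1 == (2 * n)%N then row_a mu (2 * n)%N
  else 0.

(* Sum of the fillings of the two cells in column c >= 3. *)
Definition column_filling (Phi : 'rV[int]_r -> nat)
    (mu : nat -> 'rV[int]_r) (c : nat) : nat :=
  addn (Phi (row_a mu c.-1 + mu c - mu c.-1))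
       (Phi (row_b mu c.-1 + row_a mu c - row_a mu c.-1)).

(* Rows and columns are numbered from 0 here, so entry (i, j) is m_{i+1,j+1}
   and the congruence is j + 1 = (i + 1) + k - 1 mod n; for i != j exactly one
   k in {2, ..., n} satisfies it. *)
Definition filling_matrix (Phi : 'rV[int]_r -> nat) (n : nat)
    (mu : nat -> 'rV[int]_r) : 'M[nat]_n :=
  \matrix_(i < n, j < n)
    if i == j then 0%N else
    (\sum_(2 <= k < n.+1 | j.+1 == i.+1 + k - 1 %[mod n])
       (column_filling Phi (iter i (promotion n) mu) (2 * k - 1) +
        column_filling Phi (iter i (promotion n) mu) (2 * k)))%N.

Definition M_VO (n : nat) (V : n.+1.-tuple 'rV[int]_r) : 'M[nat]_n :=
  filling_matrix Phi_O n (iota_VO V).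
Definition M_VF (n : nat) (V : n.+1.-tuple 'rV[int]_r) : 'M[nat]_n :=
  filling_matrix Phi_F n (iota_VF V).

End Weights.

(* Main.v *)
(* The corners of the 2 x 2 blocks of both growth diagrams are 2 Q(i,j), where the partitions
   Q(i,j) form one and the same growth diagram of vacillating tableaux for O and for F, and, up to
   a shift of indices, m_{i,j} = |Q(i+1,j+1)| + |Q(i,j)| - |Q(i+1,j)| - |Q(i,j+1)|.  Hence the part
   of either matrix above the diagonal determines all |Q(i,j)|, and with them the sizes of all
   partitions of the growth diagram for O: the centre of a block never comes from a vector with a
   negative entry.

   It remains to recover an oscillating tableau A from the sizes in its growth diagram.  As long
   as row 1 of the diagram is smaller than A, replace A by row 1; from the column J of the filled
   cell of row 1 on, keep A.  This deletes the first point and its partner J, and A can be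
   reconstructed from the result and J.  Row 1 itself arises from the result by inserting an
   unmatched point in column J.  Deletion commutes with such insertions and keeps the positions of
   the filled cells (a cube of local rules, in which one pair of opposite faces follows Fomin's row
   insertion rule and the other faces follow the rule of the growth diagram).  So the rows of the
   growth diagram and the iterated deletions of A have the same filled cells, and A is recovered
   by descending induction. *)

From mathcomp Require Import all_fingroup zify.
Require Import Defs.
From mathcomp Require Import all_boot all_order all_algebra.

Set Implicit Arguments.
Unset Strict Implicit.
Unset Printing Implicit Defensive.

Import Order.TTheory GRing.Theory Num.Theory.
Local Open Scope ring_scope.

(** * Sorting *)

Section Dom.
Variable r : nat.
Implicit Types (x y z A B : 'rV[int]_r) (i j k a b s t : 'I_r).
Local Notation e := (@unit_vec r).

Lemma unit_vecE a k : e a 0 k = Posz (nat_of_bool (nat_of_ord k == a)).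
Proof. by rewrite mxE eqxx /= -val_eqE /=; case: eqP. Qed.

Lemma addvE x y k : (x + y) 0 k = x 0 k + y 0 k.
Proof. by rewrite mxE. Qed.

Lemma oppvE x k : (- x) 0 k = - x 0 k.
Proof. by rewrite mxE. Qed.

Definition entE := (addvE, oppvE, unit_vecE).

Lemma is_partitionP x :
  reflect ((forall i, 0 <= x 0 i) /\ (forall i j, (i < j)%N -> x 0 j <= x 0 i))
          (is_partition x).
Proof.
apply: (iffP andP) => [[/forallP x_ge0 /forallP x_dec]|[x_ge0 x_dec]]; split=> //.
- by move=> i j /ltnW le_ij; have /forallP/(_ j) := x_dec i; rewrite le_ij.
- exact/forallP.
- apply/forallP=> i; apply/forallP=> j; apply/implyP.
  by rewrite leq_eqVlt => /orP[/eqP/val_inj-> //|/x_dec].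
Qed.

Lemma partition_ge0 x i : is_partition x -> 0 <= x 0 i.
Proof. by case/is_partitionP. Qed.

Lemma partition_le x i j : is_partition x -> (i < j)%N -> x 0 j <= x 0 i.
Proof. by case/is_partitionP=> _; apply. Qed.

Lemma dom_id x : is_partition x -> dom x = x.
Proof.
move=> /[dup] px /is_partitionP[x_ge0 _]; apply/rowP=> i; rewrite mxE.
have ->: [seq `|x 0 j| | j <- enum 'I_r] = [seq x 0 j | j <- enum 'I_r].
  by apply: eq_map => j; rewrite ger0_norm.
rewrite sorted_sort; first by rewrite (nth_map i) ?size_enum_ord // nth_ord_enum.
  exact: ge_trans.
rewrite sorted_map; have := iota_sorted 0 r; rewrite -val_enum_ord sorted_map.
apply: sub_sorted => j k /=; rewrite leq_eqVlt.
by case/orP=> [/eqP/val_inj-> |/(partition_le px)] //=.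
Qed.

Lemma dom_perm (p : 'S_r) x y : (forall k, `|x 0 k| = `|y 0 (p k)|) -> dom x = dom y.
Proof.
move=> exy; apply/rowP=> i; rewrite !mxE; congr nth.
apply/perm_sortP; [exact: ge_total|exact: ge_trans|exact: ge_anti|].
have -> : [seq `|x 0 j| | j <- enum 'I_r] = [seq `|y 0 j| | j <- [seq p k | k <- enum 'I_r]].
  by rewrite -[RHS]map_comp; apply: eq_map.
apply: perm_map; apply: uniq_perm; rewrite ?enum_uniq //.
  by rewrite map_inj_uniq ?enum_uniq //; apply: perm_inj.
move=> k; rewrite mem_enum; apply/mapP; exists ((p^-1)%g k); first by rewrite mem_enum.
by rewrite permKV.
Qed.

Lemma dom_abs x y : (forall k, `|x 0 k| = `|y 0 k|) -> dom x = dom y.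
Proof. by move=> exy; apply: (@dom_perm 1%g) => k; rewrite perm1. Qed.

Lemma dom_swap x y i j : x 0 i = y 0 j -> x 0 j = y 0 i ->
  (forall k, k != i -> k != j -> x 0 k = y 0 k) -> dom x = dom y.
Proof.
move=> xi xj xk; apply: (@dom_perm (tperm i j)) => k; congr `| _ |.
by case: tpermP => [->|->|/eqP ki /eqP kj] //; apply: xk.
Qed.

Lemma dom_add_swap x i j : x 0 i = x 0 j -> dom (x + e i) = dom (x + e j).
Proof.
have [-> //|ne] := eqVneq i j.
move=> xij; apply: (@dom_swap _ _ i j); rewrite ?entE; move: ne; rewrite -?val_eqE /=; try lia.
by move=> _ k; rewrite -!val_eqE !entE /=; lia.
Qed.

Lemma dom_sub_swap x i j : x 0 i = x 0 j -> dom (x - e i) = dom (x - e j).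
Proof.
have [-> //|ne] := eqVneq i j.
move=> xij; apply: (@dom_swap _ _ i j); rewrite ?entE; move: ne; rewrite -?val_eqE /=; try lia.
by move=> _ k; rewrite -!val_eqE !entE /=; lia.
Qed.

(** The rows as long as row t give the same sorted vector when a box is put into any of them; in the
    first one it gives a partition, so s is that row. *)
Lemma dom_add x t : is_partition x -> exists s,
  [/\ (s <= t)%N, x 0 s = x 0 t, is_partition (x + e s) & dom (x + e t) = x + e s].
Proof.
move=> px; case: (@arg_minnP _ t (fun i => x 0 i == x 0 t) val (eqxx _)) => s /eqP xs smin.
have ps : is_partition (x + e s).
  apply/is_partitionP; split=> [i|i j ij]; rewrite !entE.
    by have := partition_ge0 i px; lia.
  have := partition_le px ij.
  case: (eqVneq (nat_of_ord j) s) => [js|]; last by lia.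
  have {}js : j = s by apply: val_inj.
  by subst j; have := smin i; case: (eqVneq (x 0 i) (x 0 t)) => [_ /(_ isT) /=|]; lia.
exists s; split=> //; first exact: smin.
by rewrite (dom_add_swap (esym xs)) dom_id.
Qed.

(** Dually, the box is taken from the last of the rows as long as row t. *)
Lemma dom_sub x t : is_partition x -> 0 < x 0 t -> exists s,
  [/\ (t <= s)%N, x 0 s = x 0 t, is_partition (x - e s) & dom (x - e t) = x - e s].
Proof.
move=> px xt; case: (@arg_maxnP _ t (fun i => x 0 i == x 0 t) val (eqxx _)) => s /eqP xs smax.
have ps : is_partition (x - e s).
  apply/is_partitionP; split=> [i|i j ij]; rewrite !entE.
    have := partition_ge0 i px; case: (eqVneq (nat_of_ord i) s) => [is_|]; last by lia.
    by have {}is_ : i = s by [apply: val_inj]; subst i; lia.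
  have := partition_le px ij.
  case: (eqVneq (nat_of_ord i) s) => [is_|]; last by lia.
  have {}is_ : i = s by apply: val_inj.
  by subst i; have := smax j; case: (eqVneq (x 0 j) (x 0 t)) => [_ /(_ isT) /=|]; lia.
exists s; split=> //; first exact: smax.
by rewrite (dom_sub_swap (esym xs)) dom_id.
Qed.

(** Removal from an empty row leaves the entry -1, which sorting turns into 1: the removal becomes
    an addition. This is how a cell gets filled. *)
Lemma dom_sub0 x t : x 0 t = 0 -> is_partition (x + e t) -> dom (x - e t) = x + e t.
Proof.
move=> xt px; rewrite -[RHS]dom_id //; apply: dom_abs => k; rewrite !entE.
case: (eqVneq (nat_of_ord k) t) => [kt|]; last by lia.
by have {}kt : k = t by [apply: val_inj]; subst k; lia.
Qed.

(* Fomin's local rule for the square with corners B', B, A', A (A the largest). When B = A', the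
   box leading from B' to B lies one row above the box leading from B to A. *)
Definition face_state A B A' B' := exists a (x : 'I_r) (w : 'I_r),
  [/\ B = A - e a, A' = A - e x, B' = A - e a - e w &
      (a != x /\ w = x) \/ (a = x /\ w.+1 = a :> nat)].

Lemma succ_ord i j : (i.+1 < j)%N -> exists k : 'I_r, k = i.+1 :> nat.
Proof. by move=> lt; exists (Ordinal (ltn_trans lt (ltn_ord j))). Qed.

End Dom.

Ltac vlia := let k := fresh "k" in apply/rowP => k; rewrite ?entE /=; clear; lia.

(** * The cube of local rules *)

Lemma ord_neq r (a b : 'I_r) : a != b -> nat_of_ord a <> b.
Proof. by move=> ne /val_inj ab; rewrite ab eqxx in ne. Qed.

(** Reduces to linear arithmetic on entries and row indices. Partition hypotheses are dropped, so
    [ple] has to instantiate the inequality between two rows beforehand. *)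
Ltac fin :=
  repeat match goal with
  | H : is_true (is_partition _) |- _ => clear H
  | H : ?P -> _ |- _ => match type of P with Prop => clear H end
  | H : _ = _ :> matrix _ _ _ |- _ => clear H
  | H : is_true (~~ (_ == _)) |- _ => apply ord_neq in H
  | H : context [fun_of_matrix (_ + _)%R] |- _ => rewrite !entE in H
  end; rewrite -?val_eqE ?entE /=; lia.
Ltac ple P i j :=
  let H := fresh "H" in let Q := fresh "Q" in
  have H : (i < j)%N by [fin]; have Q := partition_le P H; clear H; rewrite ?entE in Q.

Section Cube.
Variable r : nat.
Implicit Types (A B : 'rV[int]_r) (i j k a b s t x w : 'I_r).
Local Notation e := (@unit_vec r).

(** When sorting moves a box from row t to another row s, these rows have equal length in one of A
    and B, while the step in row t is legal in the other. So A and B differ in one of the two rows,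
    which locates a. The four lemmas treat addition and removal, with the equal rows in A or in
    B. *)
Lemma top_neq_big A B a s t : is_partition (B + e t) -> B = A - e a ->
  (s <= t)%N -> A 0 s = A 0 t -> s != t -> t = a.
Proof.
move=> + eB; subst B => pB st; rewrite -?val_eqE ?entE /= => As ne; apply/val_inj => /=.
by have := partition_le pB; move/(_ s t); rewrite !entE; lia.
Qed.

Lemma top_neq_small A B a s t : is_partition (A + e t) -> B = A - e a ->
  (s <= t)%N -> B 0 s = B 0 t -> s != t -> s = a.
Proof.
move=> + eB; subst B => pB st; rewrite -?val_eqE ?entE /= => As ne; apply/val_inj => /=.
by have := partition_le pB; move/(_ s t); rewrite !entE; lia.
Qed.

Lemma bot_neq_big A B a s t : is_partition (B - e t) -> B = A - e a ->
  (t <= s)%N -> A 0 s = A 0 t -> s != t -> s = a.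
Proof.
move=> + eB; subst B => pB st; rewrite -?val_eqE ?entE /= => As ne; apply/val_inj => /=.
by have := partition_le pB; move/(_ t s); rewrite !entE; lia.
Qed.

Lemma bot_neq_small A B a s t : is_partition (A - e t) -> B = A - e a ->
  (t <= s)%N -> B 0 s = B 0 t -> s != t -> t = a.
Proof.
move=> + eB; subst B => pB st; rewrite -?val_eqE ?entE /= => As ne; apply/val_inj => /=.
by have := partition_le pB; move/(_ t s); rewrite !entE; lia.
Qed.

(** A cube of local rules for a step that adds a box to B. The last equation says that the new value
    next to A', computed through A, is also obtained through B'; this is what makes insertion
    compatible with deletion. *)
Lemma face_up A B A' B' t :
  is_partition A -> is_partition B -> is_partition A' -> is_partition B' ->
  face_state A B A' B' -> is_partition (B + e t) ->
  exists s u, [/\ dom (A + e t) = A + e s, dom (A' + e s) = A' + e u,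
    face_state (A + e s) (B + e t) (A' + e u) (dom (B' + e t)) &
    dom (A' + (dom (B' + e t) - B')) = A' + e u].
Proof.
move=> pA pB pA' pB' [a [x [w [eB eA' eB' ax]]]] pBt.
have [s [st As pAs ds]] := dom_add t pA.
have [u [us A'u pA'u du]] := dom_add s pA'.
have [v [vt B'v pB'v dv]] := dom_add t pB'.
have eB'B : B' = B - e w by rewrite eB' eB.
have nst : s != t -> t = a := top_neq_big pBt eB st As.
have nus : u != s -> u = x := top_neq_small pAs eA' us A'u.
have nvt : v != t -> v = w := top_neq_small pBt eB'B vt B'v.
exists s, u; rewrite ds du dv.
(* If rows u and v of A' have equal length, sorting moves a box added to row v of A' to row u, which
   gives the last equation. *)
suff [[a' [x' [w' [h1 h2 h3 h4]]]] h5] :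
   face_state (A + e s) (B + e t) (A' + e u) (B' + e v) /\ A' 0 u = A' 0 v.
  split=> //; first by exists a', x', w'.
  by rewrite [B' + _]addrC addrK -(dom_add_swap h5) dom_id.
subst A' B.
(* For t = a the step leads from B to A, and only then can the face pass from one of its two states
   to the other. Otherwise A receives its box in the same row, s = t. *)
have [eta|nta] := eqVneq t a.
- subst t; case: ax => [[nax wx]|[ax wa]].
  + subst w B'; have va : v = a.
      apply/eqP; apply/negP => /negP nva; have vx := nvt nva; subst v.
      by ple pA' x a; fin.
    subst v; have [us'|/[dup] neu /nus ux] := eqVneq u s.
      subst u; have nsx : s != x.
        by apply/eqP=> sx; subst s; ple pA' x a; fin.
      by split; [exists s, x, x; split; [vlia..|left] | fin].
    subst u; split; last by fin.
    exists s, s, x; split; [vlia..|right]; split=> //.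
    (* A row k strictly between x and s would violate the partition inequalities, so s is the row
       just below x. *)
    have [|] := ltnP x.+1 s; last by fin.
    move=> /[dup] xs /succ_ord[k kx]; ple pA' x k; ple pAs k s; fin.
  + subst x; have {}us' : u = s.
      apply/eqP; apply/negP => /negP neu; have ua := nus neu; subst u.
      by fin.
    subst u B'; have [sa|nsa] := eqVneq s a.
      subst s; have va : v = a.
        apply/eqP; apply/negP => /negP nva; have vw := nvt nva; subst v.
        by ple pAs w a; fin.
      by subst v; split=> //; exists a, a, w; split; [vlia..|right].
    have Aws : A 0 w = A 0 s.
      have [sw|] := eqVneq s w; first by subst s.
      by move=> nsw; ple pA s w; ple pA w a; fin.
    have vw : v = w.
      by apply: nvt; apply/eqP => va; subst v; ple pB'v w a; fin.
    subst v; split; last by fin.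
    by exists s, a, a; split; [vlia..|left].
- have {}nst : s = t by apply/eqP; apply: contraNT nta => /nst->.
  subst s; case: ax => [[nax wx]|[ax wa]].
  + subst w B'. 
    have uv : u = v.
      have [ut|/[dup] neu /nus ux] := eqVneq u t;
        have [vt'|/[dup] nev /nvt vx] := eqVneq v t; try by congruence.
      * by subst u v; ple pA'u x t; fin.
      * by subst u v; ple pB'v x t; fin.
    subst v; split=> //; have [ut|/nus ux] := eqVneq u t.
      by exists a, x, x; subst; split; [vlia..|left].
    exists a, t, t; subst; split; [vlia..|left]. split=> //. by rewrite eq_sym.
  + subst x B'.
    have vt' : v = t.
      apply/eqP; apply/negP => /negP nv; have vw := nvt nv; subst v.
      by ple pBt a t; ple pA w a; fin.
    have ut : u = t.
      apply/eqP; apply/negP => /negP nu; have ua := nus nu; subst u.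
      by ple pBt a t; fin.
    by subst u v; split=> //; exists a, a, w; split; [vlia..|right].
Qed.
(** The cells on two opposite faces of the cube are filled simultaneously: the removal meets an
    empty row of B' exactly if it meets one of A'. The removed box is then the one by which B
    exceeds B', and likewise for A and A'. *)
Lemma face_event A B A' B' s t :
  is_partition A -> is_partition B -> is_partition A' -> is_partition B' ->
  face_state A B A' B' -> is_partition (B - e t) ->
  (t <= s)%N -> A 0 s = A 0 t -> is_partition (A - e s) ->
  (B' 0 t = 0 -> [/\ A' 0 s = 0, B' = B - e t & A' = A - e s]) /\
  (A' 0 s = 0 -> B' 0 t = 0).
Proof.
move=> pA pB pA' pB' [a [x [w [eB eA' eB' ax]]]] pBt ts As pAs.
have nst : s != t -> s = a := bot_neq_big pBt eB ts As.
have Bt := partition_ge0 t pBt; have Ass := partition_ge0 s pAs.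
split=> [B't|A's].
  have tw : t = w.
    by apply/eqP/negP => /negP ne; subst B' B A'; clear - ne Bt B't; fin.
  subst w; have eB'B : B' = B - e t by rewrite eB' eB.
  suff sx : s = x.
    subst x; split=> //; subst B' B A'.
    by case: ax => [[nax tx]|[ax ta]]; [subst s; fin|subst a; fin].
  case: ax => [[nax tx]|[ax ta]].
    subst x; apply/eqP/negP => /negP /[dup] ne /nst sa; subst s B B' A'.
    by ple pA' t a; fin.
  subst x; apply: nst; apply/eqP => st; subst s B B' A'.
  by ple pAs t a; have := partition_ge0 a pA'; fin.
have sx : s = x.
  by apply/eqP/negP => /negP ne; subst B' B A'; clear - ne Ass A's; fin.
subst x; case: ax => [[nsa ws]|[sa wa]].
  subst w; have st : s = t by apply/eqP/negP=> /negP /nst sa; rewrite sa eqxx in nsa.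
  by subst t A' B' B; fin.
subst s; have [ta|nta] := eqVneq a t.
  by subst t B A'; fin.
have [wt|nwt] := eqVneq t w; first by subst w B' B A'; fin.
by subst B A'; ple pA t w; ple pBt t w; ple pA w a; fin.
Qed.

(** The dual of [face_up], with one more outcome: both cells are filled, and upper and lower values
    are exchanged. *)
Lemma face_down A B A' B' t :
  is_partition A -> is_partition B -> is_partition A' -> is_partition B' ->
  face_state A B A' B' -> is_partition (B - e t) ->
  exists s, dom (A - e t) = A - e s /\
   ((exists u v, [/\ dom (A' - e s) = A' - e u, dom (B' - e t) = B' - e v,
       face_state (A - e s) (B - e t) (A' - e u) (B' - e v) &
       dom (A' - e v) = A' - e u]) \/
    [/\ B' = B - e t, A' = A - e s, dom (A' - e s) = A & dom (B' - e t) = B]).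
Proof.
move=> pA pB pA' pB' fs pBt.
have At : 0 < A 0 t.
  have := partition_ge0 t pBt; case: fs => [a [x [w [-> _ _ _]]]].
  by rewrite !entE; lia.
have [s [ts As pAs ds]] := dom_sub pA At.
have [ev1 ev2] := face_event pA pB pA' pB' fs pBt ts As pAs.
exists s; split=> //.
(* An empty row t of B' is the filled case; otherwise row s of A' is nonempty too, by
   [face_event]. *)
have [B't|B't] := eqVneq (B' 0 t) 0.
  have [A's eB' eA'] := ev1 B't; right; split=> //.
    by rewrite dom_sub0 // eA' subrK.
  by rewrite dom_sub0 // eB' subrK.
have {}B't : 0 < B' 0 t by have := partition_ge0 t pB'; lia.
have A's : 0 < A' 0 s.
  have := partition_ge0 s pA'; case: (eqVneq (A' 0 s) 0) => [/ev2|]; lia.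
clear ev1 ev2; left.
case: fs => [a [x [w [eB eA' eB' ax]]]].
have [u [su A'u pA'u du]] := dom_sub pA' A's.
have [v [tv B'v pB'v dv]] := dom_sub pB' B't.
have eB'B : B' = B - e w by rewrite eB' eB.
have nst : s != t -> s = a := bot_neq_big pBt eB ts As.
have nus : u != s -> s = x := bot_neq_small pAs eA' su A'u.
have nvt : v != t -> t = w := bot_neq_small pBt eB'B tv B'v.
exists u, v; rewrite du dv.
suff [[a' [x' [w' [h1 h2 h3 h4]]]] h5] :
   face_state (A - e s) (B - e t) (A' - e u) (B' - e v) /\ A' 0 u = A' 0 v.
  split=> //; first by exists a', x', w'.
  by rewrite -(dom_sub_swap h5) dom_id.
subst A' B.
have [st|nst'] := eqVneq s t.
  subst s; case: ax => [[nax wx]|[ax wa]].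
    subst w B'; have [tx|ntx] := eqVneq t x.
      (* Here the boxes of A' and B' may be sorted to different rows. Then u = a and v is the row
         just above, which is the second state of the face. *)
      subst x; case: (ltngtP v u) => [vu|uv|/val_inj ?].
      - have au : a = u.
          by apply/eqP/negP => /negP ne; ple pB'v v u; fin.
        have va : v.+1 = a.
          have [|] := ltnP v.+1 a; last by clear - vu au; subst a; lia.
          move=> /[dup] lt /succ_ord[k kv]; subst u.
          by ple pB'v v k; ple pA k a; fin.
        subst u; split; first by exists a, a, v; split; [vlia..|right].
        by clear - A'u B'v va tv; fin.
      - by ple pA'u u v; fin.
      subst v; split=> //; exists a, u, u; split; [vlia..|left].
      split=> //; apply/eqP => au; subst u.
      by clear - A'u B'v nax; fin.
    have ut : u = t by apply/eqP/negP => /negP /nus tx; rewrite tx eqxx in ntx.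
    have vt : v = t by apply/eqP/negP => /negP /nvt tx; rewrite tx eqxx in ntx.
    by subst u v; split=> //; exists a, x, x; split; [vlia..|left].
  subst x B'; have ut : u = t.
    apply/eqP/negP => /negP /[dup] ne /nus ta; subst t.
    by ple pBt a u; fin.
  have vt : v = t.
    apply/eqP/negP => /negP /[dup] ne /nvt tw; subst w u.
    ple pAs t a.
    have [va|nva] := eqVneq v a; first by subst v; fin.
    by ple pA' a v; fin.
  by subst u v; split=> //; exists a, a, w; split; [vlia..|right].
have sa := nst nst'; subst s.
case: ax => [[nax wx]|[ax wa]].
  have ntx : t != x.
    by apply/eqP => tx; subst w x; ple pA' t a; clear pA'u pB'v; fin.
  have ut : u = a by apply/eqP/negP => /negP /nus ax; rewrite ax eqxx in nax.
  have vt : v = t by apply/eqP/negP => /negP /nvt tx; rewrite tx wx eqxx in ntx.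
  subst B' w u v; split; first by exists t, x, x; split; [vlia..|left].
  by clear - As nax ntx; fin.
subst x; have tw : t = w.
  apply/eqP/negP => /negP ne.
  by ple pBt t w; ple pA w a; clear - Q Q0 ne wa ts As nst'; fin.
subst w; have uv : u = v.
  case: (ltngtP v u) => [vu|uv|/val_inj //].
    by ple pB'v v u; subst B'; clear - Q A'u B'v su tv vu wa As nst'; fin.
  by ple pA'u u v; subst B'; clear - Q A'u B'v su tv uv wa As nst'; fin.
subst v; split=> //; exists t, u, u; split; try by subst B'; vlia.
by left; split=> //; apply/eqP => tu; subst u; clear - su wa; lia.
Qed.
End Cube.

(** * Slides of a single step *)

Section Steps.
Variable r : nat.
Implicit Types (A B x y : 'rV[int]_r) (a s t : 'I_r).
Local Notation e := (@unit_vec r).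

Definition weight x : int := \sum_k x 0 k.

Lemma weightD x y : weight (x + y) = weight x + weight y.
Proof. by rewrite -big_split; apply: eq_bigr => k _; rewrite addvE. Qed.

Lemma weightN x : weight (- x) = - weight x.
Proof. by rewrite /weight -sumrN; apply: eq_bigr => k _; rewrite oppvE. Qed.

Lemma weight_unit a : weight (e a) = 1.
Proof.
rewrite /weight (bigD1 a) //= big1 ?addr0 ?unit_vecE ?eqxx // => k.
by rewrite unit_vecE -val_eqE /=; case: eqP.
Qed.

Lemma weight0 : weight 0 = 0.
Proof. by apply: big1 => k _; rewrite mxE. Qed.

Definition weightE := (weightD, weightN, weight_unit, weight0).

Lemma weight_ge0 x : is_partition x -> 0 <= weight x.
Proof. by move=> px; apply: sumr_ge0 => k _; apply: partition_ge0. Qed.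

Definition box_step x y :=
  [\/ y = x, exists a, y = x + e a | exists a, y = x - e a].

Lemma is_partition0 : is_partition (0 : 'rV[int]_r).
Proof. by apply/is_partitionP; split=> *; rewrite !mxE. Qed.

Lemma transportE A x y : A + (x + y) - x = A + y.
Proof. by rewrite addrCA addrAC subrr add0r. Qed.

(** Sorting moves the changed box to a single row, and a removal from an empty row becomes an
    addition. *)
Lemma dom_box_step A x y : is_partition A -> box_step x y ->
  is_partition (dom (A + y - x)) /\ box_step A (dom (A + y - x)).
Proof.
move=> pA [->|[t ->]|[t ->]]; rewrite ?transportE.
- by rewrite addrK dom_id //; split=> //; constructor 1.
- by have [s [_ _ ps ->]] := dom_add t pA; split=> //; constructor 2; exists s.
- have [At|At] := eqVneq (A 0 t) 0.
    have -> : dom (A - e t) = dom (A + e t).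
      apply: dom_abs => k; rewrite !entE.
      case: (eqVneq (nat_of_ord k) t) => [kt|]; last by lia.
      by have {}kt : k = t by [apply: val_inj]; subst k; lia.
    by have [s [_ _ ps ->]] := dom_add t pA; split=> //; constructor 2; exists s.
  have {}At : 0 < A 0 t by have := partition_ge0 t pA; lia.
  by have [s [_ _ ps ->]] := dom_sub pA At; split=> //; constructor 3; exists s.
Qed.

(* In the second case the cell is filled, and the two rows swap their values. *)
Lemma slide_low A A' A1 (x : 'I_r) : is_partition A -> is_partition A' ->
  is_partition A1 -> A = A' + e x -> box_step A A1 ->
  ((exists y : 'I_r, A1 = dom (A' + A1 - A) + e y) /\
   dom (A1 + A' - dom (A' + A1 - A)) = A) \/
  [/\ dom (A' + A1 - A) = A, A1 = A', A = A1 + e x & A1 0 x = 0].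
Proof.
move=> pA pA' pA1 eA; have eA' : A' = A - e x by rewrite eA addrK.
case=> [e1|[s e1]|[s e1]]; subst A1; rewrite ?transportE.
- left; rewrite addrK dom_id // addrK dom_id //; split=> //.
  by exists x.
- left; have [u [us A'u pu du]] := dom_add s pA'.
  rewrite du; have [us'|/[dup] neu /(top_neq_small pA1 eA' us A'u) ux] := eqVneq u s.
    subst u; split; first by exists x; rewrite eA; vlia.
    by have -> : A + e s + A' - (A' + e s) = A by [vlia]; rewrite dom_id.
  subst u; split; first by exists s; rewrite eA; vlia.
  have -> : A + e s + A' - (A' + e x) = A' + e s by rewrite eA; vlia.
  by rewrite -(dom_add_swap A'u) -eA dom_id.
have [A's|A's] := eqVneq (A' 0 s) 0.
  have sx : s = x.
    apply: val_inj => /=; have := partition_ge0 s pA1.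
    by rewrite eA' in A's; move: A's; rewrite ?entE /=; lia.
  subst s; right; split; rewrite -?eA' ?subrK //.
  by rewrite dom_sub0 -?eA.
have {}A's : 0 < A' 0 s by have := partition_ge0 s pA'; lia.
left; have [u [su A'u pu du]] := dom_sub pA' A's; rewrite du.
have [us'|/[dup] neu /(bot_neq_small pA1 eA' su A'u) sx] := eqVneq u s.
  subst u; split; first by exists x; rewrite eA; vlia.
  by have -> : A - e s + A' - (A' - e s) = A by [vlia]; rewrite dom_id.
subst s; split; first by exists u; rewrite eA; vlia.
have -> : A - e x + A' - (A' - e u) = A' + e u by rewrite eA; vlia.
by rewrite (dom_add_swap A'u) -eA dom_id.
Qed.

(** Once the lower row A is ahead of the upper row B, no cell is filled: a row of B that loses a box
    is nonempty in A as well. So A stays one box ahead. *)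
Lemma slide_high A B B1 (a : 'I_r) : is_partition A -> is_partition B1 ->
  A = B + e a -> box_step B B1 -> exists b : 'I_r, dom (A + B1 - B) = B1 + e b.
Proof.
move=> pA pB1 eA; have eB : B = A - e a by rewrite eA addrK.
case=> [e1|[t e1]|[t e1]]; subst B1; rewrite ?transportE.
- by exists a; rewrite addrK dom_id.
- have [s [st As ps ->]] := dom_add t pA.
  have [st'|/(top_neq_big pB1 eB st As) ta] := eqVneq s t.
    by subst s; exists a; rewrite eA; vlia.
  by subst t; exists s; rewrite eA; vlia.
have At : 0 < A 0 t by have := partition_ge0 t pB1; rewrite eA !entE; lia.
have [s [ts As ps ->]] := dom_sub pA At.
have [st'|/(bot_neq_big pB1 eB ts As) sa] := eqVneq s t.
  by subst s; exists a; rewrite eA; vlia.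
by subst s; exists t; rewrite eA; vlia.
Qed.

(** A displacement by sorting would need a row above the first one, so an extra box in row 0 stays
    there. *)
Lemma slide_top A B B1 (a : 'I_r) : is_partition A -> is_partition B1 ->
  A = B + e a -> a = 0 :> nat -> box_step B B1 -> dom (A + B1 - B) = B1 + e a.
Proof.
move=> pA pB1 eA a0; have eB : B = A - e a by rewrite eA addrK.
case=> [e1|[t e1]|[t e1]]; subst B1; rewrite ?transportE.
- by rewrite addrK dom_id.
- have [s [st As ps ->]] := dom_add t pA.
  have [st'|/(top_neq_big pB1 eB st As) ta] := eqVneq s t.
    by subst s; rewrite eA; vlia.
  have {}st : s = t by apply: val_inj => /=; subst t; lia.
  by subst s t; rewrite eA; vlia.
have At : 0 < A 0 t by have := partition_ge0 t pB1; rewrite eA !entE; lia.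
have [s [ts As ps ->]] := dom_sub pA At.
have [st'|/(bot_neq_big pB1 eB ts As) sa] := eqVneq s t.
  by subst s; rewrite eA; vlia.
have {}st : s = t by apply: val_inj => /=; subst s; lia.
by subst s t; rewrite eA; vlia.
Qed.

(** Collects the three kinds of step; in the second alternative both cells are filled. *)
Lemma face_step A B A' B' B1 (A1 := dom (A + B1 - B))
    (A1' := dom (A' + A1 - A)) (B1' := dom (B' + B1 - B)) :
  is_partition A -> is_partition B -> is_partition A' -> is_partition B' ->
  is_partition B1 -> face_state A B A' B' -> box_step B B1 ->
  (face_state A1 B1 A1' B1' /\ A1' = dom (A' + B1' - B')) \/
  [/\ A' = A1, B' = B1, A1' = A & B1' = B].
Proof.
move=> pA pB pA' pB' pB1 fs st; rewrite /A1' /B1' /A1.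
case: st pB1 => [->|[t ->]|[t ->]] pB1; rewrite ?transportE.
- left; rewrite !addrK (dom_id pA) ?addrK (dom_id pA') (dom_id pB') ?addrK.
  by rewrite (dom_id pA').
- have [s [u [ds du fs' d']]] := face_up pA pB pA' pB' fs pB1.
  left; rewrite ds transportE du; split=> //.
  by rewrite -d' addrA.
have [s [ds [[u [v [du dv fs' d']]]|[eB' eA' dA dB]]]] := face_down pA pB pA' pB' fs pB1.
  by left; rewrite ds transportE du dv transportE d'.
by right; rewrite ds transportE.
Qed.

(** The face arises in the column of the inserted point, whose box goes to the first empty row: a
    for B, u for B'. Either u = a, or box b was alone in its row and u = b is the row just above a.
    These are the two states. *)
Lemma face_start A B B' (a b : 'I_r) : is_partition A -> is_partition B -> is_partition B' ->
  A = B + e a -> B 0 a = 0 -> B = B' + e b ->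
  exists2 u : 'I_r, dom (B' + e a) = B' + e u /\ B' 0 u = 0 & face_state A B (B' + e u) B'.
Proof.
move=> pA pB pB' eA Ba eB.
have Ba' : B' 0 a = 0.
  by have := partition_ge0 a pB'; move: Ba; rewrite eB !entE; lia.
have [u [ua B'u pu du]] := dom_add a pB'.
exists u; first by rewrite du B'u.
have [eua|neu] := eqVneq u a.
  subst u; exists a, b, b; split; try by subst A B; vlia.
  by left; split=> //; apply/eqP => ab; subst b B; move: Ba; rewrite ?entE /=; lia.
have ub : u = b.
  apply: val_inj => /=; have : (u < a)%N by move: neu; rewrite -val_eqE /=; lia.
  by move=> /[dup] ? /(partition_le pA); subst A B; move: Ba; rewrite ?entE /=; lia.
subst u; exists a, a, b; split; try by subst A B; vlia.
right; split=> //; have [|] := ltnP b.+1 a; last first.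
  by move: neu; rewrite -val_eqE /=; lia.
move=> /[dup] lt /succ_ord[k kb].
have lt1 : (b < k)%N by lia.
have lt2 : (k < a)%N by lia.
have := partition_le pA lt2; have := partition_le pB' lt1.
by subst A B; move: Ba; rewrite ?entE /=; lia.
Qed.

End Steps.

(** * Rows of the growth diagram and deletion of the first point *)

Section Paths.
Variables (r N : nat).
Implicit Types (A B C : nat -> 'rV[int]_r) (h c J : nat).
Local Notation e := (@unit_vec r).

(** The row of the growth diagram below row h, given by A. Columns are counted absolutely and row h
    starts in column h, so the new row is 0 up to column h+1. *)
Fixpoint slide h A c : 'rV[int]_r :=
  if c is c'.+1 then
    if (h < c')%N then dom (slide h A c' + A c - A c') else 0
  else 0.

Lemma slide0 h A c : (c <= h.+1)%N -> slide h A c = 0.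
Proof. by case: c => [|c] //= ch; rewrite ltnNge -ltnS ch. Qed.

Lemma slideS h A c : (h < c)%N ->
  slide h A c.+1 = dom (slide h A c + A c.+1 - A c).
Proof. by move=> /= ->. Qed.

Definition box_path h A :=
  [/\ A h = 0, forall c, (h <= c <= N)%N -> is_partition (A c) &
      forall c, (h <= c < N)%N -> box_step (A c) (A c.+1)].

Definition agree h A B := forall c, (h <= c <= N)%N -> A c = B c.

Lemma slide_eq h A B c : (forall d, (h <= d <= c)%N -> A d = B d) ->
  slide h A c = slide h B c.
Proof.
elim: c => [|c IHc] // AB; have [hc|ch] := ltnP h c; last by rewrite !slide0.
rewrite !slideS // !AB ?IHc //; try lia.
by move=> d hd; apply: AB; lia.
Qed.

Lemma slide_agree h A B : agree h A B -> agree h (slide h A) (slide h B).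
Proof. by move=> AB c hc; apply: slide_eq => d hd; apply: AB; lia. Qed.

Lemma box_path_slide h A : box_path h A -> box_path h.+1 (slide h A).
Proof.
move=> [Ah pA sA]; have p c : (h < c <= N)%N -> is_partition (slide h A c).
  elim: c => [|c IHc] // /andP[hc cN].
  have [hc'|ch] := ltnP h c; last by rewrite slide0 //; apply: is_partition0.
  rewrite slideS //; apply: (dom_box_step _ (sA _ _)).1; last by lia.
  by apply: IHc; lia.
split=> [|//|c hc]; first by rewrite slide0.
by rewrite slideS; [apply: (dom_box_step _ (sA _ _)).2; [apply: p|]|]; lia.
Qed.

(* [hit h A c] says that the cell of the row below A in column c is filled; [del h A] is A with the
   point h and its partner deleted. *)
Definition low h A c := weight (slide h A c) < weight (A c).
Definition hit h A c := low h A c.-1 && ~~ low h A c.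
Definition del h A c := if low h A c then slide h A c else A c.

Lemma low_agree h A B c : agree h A B -> (h <= c <= N)%N -> low h A c = low h B c.
Proof. by move=> AB hc; rewrite /low (AB c) // (slide_agree AB). Qed.

Lemma hit_agree h A B c : agree h A B -> (h < c <= N)%N -> hit h A c = hit h B c.
Proof. by move=> AB hc; rewrite /hit !(low_agree AB) //; lia. Qed.

Lemma del_agree h A B : agree h A B -> agree h (del h A) (del h B).
Proof. by move=> AB c hc; rewrite /del (low_agree AB) // (AB c) // (slide_agree AB). Qed.

Lemma slide_stay h A c : box_path h A -> A h.+1 = 0 -> (h < c <= N)%N -> slide h A c = A c.
Proof.
move=> [Ah pA sA] Ah1; elim: c => [|c IHc] // /andP[hc cN].
have [hc'|ch] := ltnP h c; last first.
  have -> : c.+1 = h.+1 by lia.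
  by rewrite slide0.
rewrite slideS // IHc; last by lia.
by rewrite addrC addrA addNr add0r dom_id //; apply: pA; lia.
Qed.

Lemma low_stay h A c : box_path h A -> A h.+1 = 0 -> (h < c <= N)%N -> low h A c = false.
Proof. by move=> pA A0 hc; rewrite /low slide_stay // ltxx. Qed.

Lemma del_stay h A : box_path h A -> A h.+1 = 0 -> agree h.+1 (del h A) A.
Proof. by move=> pA A0 c hc; rewrite /del low_stay. Qed.

Lemma box_path_first h A : box_path h A -> (h < N)%N -> A h.+1 != 0 ->
  exists2 a : 'I_r, A h.+1 = e a & a = 0 :> nat.
Proof.
move=> [Ah pA sA] hN; have p1 : is_partition (A h.+1) by apply: pA; lia.
have [->|[a]|[a]] : box_step (A h) (A h.+1) by apply: sA; lia.
- by rewrite Ah eqxx.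
- rewrite Ah add0r => A1 _; exists a => //.
  apply/eqP; rewrite -leqn0 leqNgt; apply/negP => a0.
  have lt : (Ordinal (ltn_trans a0 (ltn_ord a)) < a)%N by [].
  by have := partition_le p1 lt; rewrite A1 !entE /=; lia.
- by rewrite Ah => A1; have := partition_ge0 a p1; rewrite A1 !entE mxE; lia.
Qed.

Lemma low_first h A : box_path h A -> (h < N)%N -> A h.+1 != 0 -> low h A h.+1.
Proof.
move=> pA hN /(box_path_first pA hN)[a A1 _].
by rewrite /low slide0 // A1 !weightE.
Qed.

Lemma low_weight h A c (x : 'I_r) : A c = slide h A c + e x -> low h A c.
Proof. by rewrite /low => {1}->; rewrite !weightE; lia. Qed.

Lemma high_weight h A c (x : 'I_r) : slide h A c = A c + e x -> low h A c = false.
Proof. by rewrite /low => {1}->; rewrite !weightE; apply/negbTE; lia. Qed.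

(** The first step puts A one box ahead of the row below. The local rules keep the difference at one
    box, and only a filled cell reverses its sign. *)
Lemma slide_cases h A c : box_path h A -> A h.+1 != 0 -> (h < c <= N)%N ->
  if low h A c then exists x : 'I_r, A c = slide h A c + e x
  else exists x : 'I_r, slide h A c = A c + e x.
Proof.
move=> pA A1; elim: c => [|c IHc] // /andP[hc cN].
have [hc'|ch] := ltnP h c; last first.
  have {ch hc} ch : c = h by lia.
  subst c.
  rewrite low_first // slide0 //.
  by have [a -> _] := box_path_first pA cN A1; exists a; rewrite add0r.
have [_ pS _] := box_path_slide pA; have [_ pA' sA] := pA.
have st : box_step (A c) (A c.+1) by apply: sA; lia.
have p0 : is_partition (A c) by apply: pA'; lia.
have p1 : is_partition (A c.+1) by apply: pA'; lia.
have q0 : is_partition (slide h A c) by apply: pS; lia.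
have := IHc; case: ifP => lc /(_ _)[|x Ax]; try lia.
  have [[[y eA] _]|[eA _ eA1 _]] := slide_low p0 q0 p1 Ax st; rewrite -slideS // in eA.
    by rewrite (low_weight eA); exists y.
  by rewrite (@high_weight _ _ _ x) -?eA1 //; exists x; rewrite eA -eA1.
have [y eA] := slide_high q0 p1 Ax st.
by rewrite -slideS // in eA; rewrite (high_weight eA); exists y.
Qed.

(** By [slide_high] the difference never changes back, so a row has at most one hit. *)
Lemma low_anti h A c : box_path h A -> (h < c < N)%N -> low h A c.+1 -> low h A c.
Proof.
move=> pA hc; have [A1|A1] := eqVneq (A h.+1) 0; first by rewrite !low_stay //; lia.
have [_ pS _] := box_path_slide pA; have [_ pA' sA] := pA.
have := @slide_cases h A c pA A1; case: ifP => // lc /(_ _)[|x Ax]; first by lia.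
have [y] : exists b : 'I_r, dom (slide h A c + A c.+1 - A c) = A c.+1 + e b.
  by apply: slide_high Ax (sA _ _); [apply: pS|apply: pA'|]; lia.
by rewrite -slideS; [move/high_weight->|lia].
Qed.

Lemma low_le h A c d : box_path h A -> (h < c <= d)%N -> (d <= N)%N -> low h A d -> low h A c.
Proof.
move=> pA; elim: d => [|d IHd] /andP[hc cd] dN; first by lia.
move: cd; rewrite leq_eqVlt => /orP[/eqP<- //|cd] /(low_anti pA) ld.
by apply: IHd; [lia|lia|apply: ld; lia].
Qed.

Lemma low_step h A c : box_path h A -> A h.+1 != 0 -> (h < c < N)%N -> low h A c ->
  exists x : 'I_r,
   ((exists y : 'I_r, A c.+1 = slide h A c.+1 + e y) /\
    dom (A c.+1 + slide h A c - slide h A c.+1) = A c) \/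
   [/\ slide h A c.+1 = A c, A c.+1 = slide h A c, A c = A c.+1 + e x &
       A c.+1 0 x = 0].
Proof.
move=> pA A1 hc lc; have [_ pS _] := box_path_slide pA; have [_ pA' sA] := pA.
have := @slide_cases h A c pA A1; rewrite lc => /(_ _)[|x Ax]; first by lia.
exists x; rewrite slideS; last by lia.
by apply: slide_low => //; [apply: pA'|apply: pS|apply: pA'|apply: sA]; lia.
Qed.

(** The local rule read backwards: while A is ahead, it is determined by its next value and the row
    below. *)
Lemma low_next h A c : box_path h A -> A h.+1 != 0 -> (h < c < N)%N -> low h A c ->
  low h A c.+1 -> dom (A c.+1 + slide h A c - slide h A c.+1) = A c.
Proof.
move=> pA A1 hc lc l1; have [x [[]//|[eA _ eA1 _]]] := low_step pA A1 hc lc.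
by move: l1; rewrite (@high_weight _ _ _ x) // eA -eA1.
Qed.

(** At the filled cell the two rows exchange their values, and the box that A loses was alone in its
    row. *)
Lemma hit_next h A c : box_path h A -> A h.+1 != 0 -> (h < c < N)%N -> low h A c ->
  ~~ low h A c.+1 ->
  exists x : 'I_r, [/\ slide h A c.+1 = A c, A c.+1 = slide h A c,
                        A c = A c.+1 + e x & A c.+1 0 x = 0].
Proof.
move=> pA A1 hc lc l1; have [x [[[y /low_weight eA] _]|]] := low_step pA A1 hc lc.
  by rewrite eA in l1.
by exists x.
Qed.

(** The deletion switches to A at the hit, where A takes the value that the row below had one column
    earlier; so it pauses there. *)
Lemma box_path_del h A : (h < N)%N -> box_path h A -> box_path h.+1 (del h A).
Proof.
move=> hN pA; have [_ pS sS] := box_path_slide pA; have [_ pA' sA] := pA.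
split=> [|c hc|c hc].
- rewrite /del; case: ifPn => [_|]; first by rewrite slide0.
  by apply: contraNeq => /(low_first pA hN).
- by rewrite /del; case: ifP => _; [apply: pS|apply: pA'; lia].
have [A1|A1] := eqVneq (A h.+1) 0.
  by rewrite !del_stay //; [apply: sA|..]; lia.
rewrite /del; case: ifPn => l0; case: ifPn => l1.
- by apply: sS.
- by have [x [_ -> _ _]] := hit_next pA A1 hc l0 l1; constructor 1.
- by rewrite (low_anti pA hc l1) in l0.
- by apply: sA; lia.
Qed.

Lemma del_end h A : (h < N)%N -> box_path h A -> A N = 0 -> del h A N = 0.
Proof.
move=> hN pA AN; rewrite /del AN; case: ifP => //; rewrite /low AN weight0.
have [_ pS _] := box_path_slide pA; have pN : is_partition (slide h A N) by apply: pS; lia.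
by have := weight_ge0 pN; lia.
Qed.

End Paths.

(** * Insertion of an unmatched point *)

Section Insertion.
Variables (r N : nat).
Implicit Types (A B C : nat -> 'rV[int]_r) (h c J : nat).
Local Notation e := (@unit_vec r).
Local Notation box_path := (@box_path r N).
Local Notation agree := (@agree r N).

(* A is B with an unmatched point inserted in column J. *)
Definition inserted_at h J A B :=
  [/\ (h < J <= N)%N, forall c, (h <= c < J)%N -> A c = B c, B J = B J.-1,
      exists2 a : 'I_r, A J = B J + e a & B J 0 a = 0 &
      forall c, (J <= c < N)%N -> A c.+1 = dom (A c + B c.+1 - B c)].

Definition linked h A B := agree h A B \/ exists J, inserted_at h J A B.

(** Let J be the column of the hit. Before J the deletion is the row below itself, at J it pauses,
    and from J on it is A, which the row below follows by the local rule with one box more. Without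
    a hit the two coincide. *)
Lemma slide_linked h A : (h < N)%N -> box_path h A -> linked h.+1 (slide h A) (del h A).
Proof.
move=> hN pA; have [A1|A1] := eqVneq (A h.+1) 0.
  by left=> c hc; rewrite (del_stay pA) // (slide_stay pA).
have [lN|lN] := boolP (low h A N).
  by left=> c hc; rewrite /del (low_le pA _ _ lN).
have : exists J, (h < J)%N && ~~ low h A J by exists N; rewrite hN.
move=> /ex_minnP[J /andP[hJ lJ] Jmin].
have JN : (J <= N)%N by apply: Jmin; rewrite hN.
have lowJ c : (h < c < J)%N -> low h A c.
  by move=> hc; apply: contraT => lc; have := Jmin c; rewrite lc; lia.
have nlowJ c : (J <= c <= N)%N -> low h A c = false.
  move=> hc; apply: contraNF lJ; apply: (low_le pA); lia.
have hJ1 : (h.+1 < J)%N.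
  rewrite ltn_neqAle hJ andbT; apply: contraNneq lJ => <-; exact: (low_first pA).
have eJ : J = J.-1.+1 by lia.
have hJ' : (h < J.-1 < N)%N by lia.
have lJ' : low h A J.-1 by apply: lowJ; lia.
have := hit_next pA A1 hJ' lJ'; rewrite -eJ => /(_ lJ)[x [eS eA eA1 Ax]].
right; exists J; split=> [|c hc|||c hc].
- lia.
- by rewrite /del lowJ.
- by rewrite /del lJ' (negbTE lJ).
- by exists x; rewrite /del (negbTE lJ) // eS.
- by rewrite slideS ?/del ?nlowJ //; lia.
Qed.

(** The box of a point inserted at the very beginning stays in row 0. So the row below A is B, A has
    no hit, and deleting its first point gives B; B itself begins with a pause and is not changed by
    deletion. *)
Lemma inserted_first h A B : (h < N)%N -> box_path h A -> box_path h B ->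
  inserted_at h h.+1 A B ->
  (forall c, (h.+1 < c <= N)%N -> hit h A c = hit h B c) /\
  agree h.+1 (del h A) (del h B).
Proof.
move=> hN pA pB [_ AB B1 [a AJ _] AS].
have {}B1 : B h.+1 = 0 by rewrite B1; case: pB.
have A1 : A h.+1 != 0.
  by rewrite AJ B1 add0r; apply/eqP => /(congr1 (@weight r)); rewrite !weightE.
have [b Ab b0] := box_path_first pA hN A1.
have Abox c : (h < c <= N)%N -> A c = B c + e b.
  elim: c => [|c IHc] // /andP[hc cN].
  have [hc'|ch] := ltnP h c; last first.
    by have -> : c = h by [lia]; rewrite B1 add0r.
  rewrite AS; last by lia.
  case: pA pB => [_ pA _] [_ pB sB].
  by apply: slide_top b0 (sB _ _); [apply: pA|apply: pB|apply: IHc|]; lia.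
have SA c : (h < c <= N)%N -> slide h A c = B c.
  elim: c => [|c IHc] // /andP[hc cN].
  have [hc'|ch] := ltnP h c; last first.
    by have -> : c = h by [lia]; rewrite slide0.
  rewrite slideS // IHc ?Abox //; try lia.
  have -> : B c + (B c.+1 + e b) - (B c + e b) = B c.+1 by vlia.
  by rewrite dom_id //; case: pB => _ p _; apply: p; lia.
have lA c : (h < c <= N)%N -> low h A c.
  by move=> hc; apply: (@low_weight _ _ _ _ b); rewrite SA // Abox.
split=> c hc.
  by rewrite /hit (lA c) ?(low_stay pB B1) ?andbF //; lia.
by rewrite (del_stay pB) // /del lA ?SA.
Qed.

Lemma face_low h A B c : face_state (A c) (B c) (slide h A c) (slide h B c) ->
  low h A c /\ low h B c.
Proof.
move=> [a [x [w [eB eA' eB' _]]]]; split.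
  by apply: (@low_weight _ _ _ _ x); rewrite eA' subrK.
by apply: (@low_weight _ _ _ _ w); rewrite eB' -eB subrK.
Qed.

(** In the second alternative both paths are hit in column c+1, and the face ends. *)
Lemma face_path_step h J A B c : box_path h A -> box_path h B -> inserted_at h J A B ->
  (J <= c < N)%N -> face_state (A c) (B c) (slide h A c) (slide h B c) ->
  (face_state (A c.+1) (B c.+1) (slide h A c.+1) (slide h B c.+1) /\
   slide h A c.+1 = dom (slide h A c + slide h B c.+1 - slide h B c)) \/
  (low h A c.+1 = false /\ low h B c.+1 = false).
Proof.
move=> pA pB [hJ _ _ _ AS] hc fs; have [_ pSA _] := box_path_slide pA.
have [_ pSB _] := box_path_slide pB; case: pA pB => _ pA _ [_ pB sB].
have := @face_step _ (A c) (B c) (slide h A c) (slide h B c) (B c.+1).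
cbv zeta; rewrite -AS // -(@slideS _ h A c) -?(@slideS _ h B c); try lia.
case=> //; [apply: pA|apply: pB|apply: pSA|apply: pSB|apply: pB|apply: sB|by left|]; try lia.
case=> eA eB eA' eB'; right; case: fs => [a [x [w [fB fA' fB' _]]]]; split.
  by apply: (@high_weight _ _ _ _ x); rewrite -eA eA' fA' subrK.
by apply: (@high_weight _ _ _ _ w); rewrite -eB eB' fB' -fB subrK.
Qed.

(** If B is still low when the point is inserted, A, B and the rows below them form a face: created
    in column J by [face_start], continued by [face_path_step], ended by a simultaneous hit. In all
    cases A and B are low in the same columns, so the deletions switch together. *)
Lemma inserted_del h J A B : (h < N)%N -> box_path h A -> box_path h B ->
  inserted_at h J A B -> (h.+1 < J)%N ->
  (forall c, (h.+1 < c <= N)%N -> hit h A c = hit h B c) /\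
  inserted_at h.+1 J (del h A) (del h B).
Proof.
move=> hN pA pB /[dup] insAB [hJ AB BJ [a AJ Ba] AS] h1J.
have A1B1 : A h.+1 = B h.+1 by apply: AB; lia.
have [B1|B1] := eqVneq (B h.+1) 0.
  have A1 : A h.+1 = 0 by rewrite A1B1.
  split=> [c hc|]; first by rewrite /hit !(low_stay pA A1) ?(low_stay pB B1) //; lia.
  split=> [|c hc|||c hc]; rewrite ?(del_stay pA A1) ?(del_stay pB B1) //; try lia.
  - by apply: AB; lia.
  - by exists a.
  - by apply: AS.
have A1 : A h.+1 != 0 by rewrite A1B1.
have SAB c : (h <= c < J)%N -> slide h A c = slide h B c.
  by move=> hc; apply: slide_eq => d hd; apply: AB; lia.
have lAB c : (h <= c < J)%N -> low h A c = low h B c.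
  by move=> hc; rewrite /low SAB // AB.
have [_ pSB _] := box_path_slide pB.
have eJ : J = J.-1.+1 by lia.
have hJ' : (h < J.-1 <= N)%N by lia.
(* B pauses in column J, hence so does the row below it. *)
have BJ' : slide h B J = slide h B J.-1.
  rewrite {1}eJ slideS -?eJ; last by lia.
  by rewrite BJ addrK dom_id //; apply: pSB; lia.
have startJ : low h B J.-1 -> face_state (A J) (B J) (slide h A J) (slide h B J) /\
    exists2 u : 'I_r, slide h A J = slide h B J + e u & slide h B J 0 u = 0.
  move=> lB; have := slide_cases pB B1 hJ'; rewrite lB => -[b eB].
  have [||||u [du Bu] fs] := @face_start _ (A J) (B J) (slide h B J.-1) a b _ _ _ AJ Ba.
  - by case: pA => _ p _; apply: p; lia.
  - by case: pB => _ p _; apply: p; lia.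
  - exact: pSB.
  - by rewrite BJ eB.
  have eA : slide h A J = slide h B J.-1 + e u.
    rewrite {1}eJ slideS -?eJ; last by lia.
    rewrite SAB; last by lia.
    rewrite AJ [A J.-1]AB -?BJ ?transportE //; lia.
  by rewrite eA BJ'; split=> //; exists u.
have state c : (J <= c <= N)%N -> low h A c = low h B c /\
    (low h A c -> face_state (A c) (B c) (slide h A c) (slide h B c)).
  elim: c => [|c IHc] hc; first by lia.
  have [cJ|Jc] := ltnP c J.
    have <- : J = c.+1 by lia.
    have [lB|lB] := boolP (low h B J.-1).
      by have [fs _] := startJ lB; have [-> ->] := face_low fs.
    have nl D : box_path h D -> ~~ low h D J.-1 -> low h D J = false.
      move=> pD lD; apply: contraNF lD; rewrite {1}eJ; apply: (@low_anti _ N) => //; lia.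
    rewrite !nl // lAB //; lia.
  have [|lc fs] := IHc; first by lia.
  have [lA|lA] := boolP (low h A c); last first.
    have nl D : box_path h D -> ~~ low h D c -> low h D c.+1 = false.
      by move=> pD lD; apply: contraNF lD; apply: (@low_anti _ N) => //; lia.
    by rewrite !nl // -lc.
  have [|[fs' _]|[-> ->] //] := face_path_step pA pB insAB _ (fs lA); first by lia.
  by have [-> ->] := face_low fs'.
have lE c : (h < c <= N)%N -> low h A c = low h B c.
  move=> hc; have [cJ|Jc] := ltnP c J; first by apply: lAB; lia.
  by have [] := state c; lia.
split=> [c hc|]; first by rewrite /hit !lE //; lia.
split=> [|c hc|||c hc]; first by lia.
- by rewrite /del lE ?SAB ?AB //; lia.
- have [lB|lB] := boolP (low h B J.-1).
    by have [/face_low[_ lBJ] _] := startJ lB; rewrite /del lBJ lB.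
  rewrite /del (negbTE lB); case: ifP => // lBJ.
  by rewrite (low_anti pB _ _) -?eJ // in lB; lia.
- have [lB|lB] := boolP (low h B J.-1).
    by have [/face_low[lAJ lBJ] [u eA Bu]] := startJ lB; rewrite /del lAJ lBJ; exists u.
  have lBJ : low h B J = false.
    by apply: contraNF lB; rewrite {1}eJ; apply: (@low_anti _ N) => //; lia.
  by rewrite /del lE ?lBJ //; exists a.
have [lA1|lA1] := boolP (low h A c.+1).
  have lA : low h A c by apply: (low_anti pA) lA1 => //; lia.
  have [|_ /(_ lA) fs] := state c; first by lia.
  rewrite /del -!lE ?lA ?lA1; try lia.
  have [||[lA1' _]] := face_path_step pA pB insAB _ fs; first by lia.
    by case.
  by rewrite lA1' in lA1.
have [lA|lA] := boolP (low h A c); last first.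
  by rewrite /del -!lE ?(negbTE lA) ?(negbTE lA1) ?AS //; lia.
rewrite /del -!lE ?lA ?(negbTE lA1); try lia.
have lB : low h B c by rewrite -lE //; lia.
have lB1 : ~~ low h B c.+1 by rewrite -lE //; lia.
have hc' : (h < c < N)%N by lia.
(* At the common hit both deletions pause, so the insertion rule is applied with increment 0. *)
have [x [_ eA _ _]] := hit_next pA A1 hc' lA lA1.
have [y [_ eB _ _]] := hit_next pB B1 hc' lB lB1.
rewrite -eA -eB addrK dom_id //; case: pA => _ p _; apply: p; lia.
Qed.

Lemma linked_del h A B : (h < N)%N -> box_path h A -> box_path h B -> linked h A B ->
  (forall c, (h.+1 < c <= N)%N -> hit h A c = hit h B c) /\
  linked h.+1 (del h A) (del h B).
Proof.
move=> hN pA pB [AB|[J insAB]].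
  split=> [c hc|]; first by apply: (hit_agree AB); lia.
  by left=> c hc; apply: (del_agree AB); lia.
have [hJ|Jh] := ltnP h.+1 J.
  have [hitAB ins'] := inserted_del hN pA pB insAB hJ.
  by split=> //; right; exists J.
have eJ : J = h.+1 by case: insAB; lia.
subst J; have [hitAB dAB] := inserted_first hN pA pB insAB.
by split=> //; left.
Qed.

End Insertion.

(** * Reconstruction from the sizes *)

Section Reconstruction.
Variables (r N : nat).
Implicit Types (A B C mu : nat -> 'rV[int]_r) (h c J : nat).
Local Notation e := (@unit_vec r).
Local Notation box_path := (@box_path r N).
Local Notation agree := (@agree r N).
Local Notation linked := (@linked r N).

(** Each further row brings one more insertion, and several insertions do not in general combine
    into one; hence the closure. *)
Inductive chain h : (nat -> 'rV[int]_r) -> (nat -> 'rV[int]_r) -> Prop :=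
| chain_refl A : chain h A A
| chain_step A C B : linked h A C -> box_path h C -> chain h C B -> chain h A B.

Lemma chain_del h A B : (h < N)%N -> box_path h A -> chain h A B ->
  (forall c, (h.+1 < c <= N)%N -> hit h A c = hit h B c) /\
  chain h.+1 (del h A) (del h B).
Proof.
move=> hN + AB; elim: AB => {A B} [A|A C B AC pC CB IH] pA.
  by split=> //; apply: chain_refl.
have [hitAC dAC] := linked_del hN pA pC AC; have [hitCB dCB] := IH pC.
split=> [c hc|]; first by rewrite hitAC ?hitCB.
exact: chain_step dAC (box_path_del hN pC) dCB.
Qed.

Fixpoint rows mu h := if h is h'.+1 then slide h' (rows mu h') else mu.
Fixpoint residue mu h := if h is h'.+1 then del h' (residue mu h') else mu.

Lemma box_path_rows mu h : box_path 0 mu -> box_path h (rows mu h).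
Proof. by move=> p0; elim: h => //= h; apply: box_path_slide. Qed.

Lemma box_path_residue mu h : (h <= N)%N -> box_path 0 mu -> box_path h (residue mu h).
Proof. by move=> + p0; elim: h => //= h IHh hN; apply: box_path_del (IHh _); lia. Qed.

Lemma residue_end mu h : (h <= N)%N -> box_path 0 mu -> mu N = 0 -> residue mu h N = 0.
Proof.
move=> + p0 muN; elim: h => //= h IHh hN; apply: del_end (IHh _) => //; last by lia.
by apply: box_path_residue => //; lia.
Qed.

(** Row h+1 is linked to the deletion of row h, and deletion applied to the whole chain for h leads
    from there to the next residue. *)
Lemma rows_chain mu h : (h <= N)%N -> box_path 0 mu -> chain h (rows mu h) (residue mu h).
Proof.
move=> + p0; elim: h => [|h IHh] hN /=; first exact: chain_refl.
have pR := box_path_rows h p0.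
have [_ dRA] := chain_del hN pR (IHh (ltnW hN)).
exact: chain_step (slide_linked hN pR) (box_path_del hN pR) dRA.
Qed.

Lemma hit_rows mu h c : (h.+1 < c <= N)%N -> box_path 0 mu ->
  hit h (rows mu h) c = hit h (residue mu h) c.
Proof.
move=> hc p0; have hN : (h < N)%N by lia.
have [hitRA _] := chain_del hN (box_path_rows h p0) (rows_chain (ltnW hN) p0).
exact: hitRA.
Qed.

(** A ends at 0, where the row below cannot be smaller; so A does not stay low, and the first column
    that is not low is a hit. *)
Lemma exists_hit h A : (h < N)%N -> box_path h A -> A N = 0 -> A h.+1 != 0 ->
  exists2 J, (h.+1 < J <= N)%N & hit h A J.
Proof.
move=> hN pA AN A1; have lN : ~~ low h A N.
  have [_ pS _] := box_path_slide pA.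
  by rewrite /low AN weight0 -leNgt; apply/weight_ge0/pS; lia.
have : exists J, (h < J)%N && ~~ low h A J by exists N; rewrite hN.
move=> /ex_minnP[J /andP[hJ lJ] Jmin].
have hJ1 : (h.+1 < J)%N.
  rewrite ltn_neqAle hJ andbT; apply: contraNneq lJ => <-; exact: (low_first pA).
exists J; first by rewrite hJ1 /=; apply: Jmin; rewrite hN.
rewrite /hit lJ andbT; apply: contraT => lJ'.
by have := Jmin J.-1; rewrite lJ'; lia.
Qed.

Lemma hit_nonzero h A J : box_path h A -> (h.+1 < J <= N)%N -> hit h A J -> A h.+1 != 0.
Proof.
move=> pA hJ; apply: contraTneq => A1.
by rewrite /hit (low_stay pA A1) //; lia.
Qed.

Lemma first_empty_row (x : 'rV[int]_r) (i j : 'I_r) : is_partition (x + e i) ->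
  is_partition (x + e j) -> x 0 i = 0 -> x 0 j = 0 -> i = j.
Proof.
move=> pi pj xi xj; case: (ltngtP i j) => [lt|lt|/val_inj //].
  by have := partition_le pj lt; rewrite !entE /=; lia.
by have := partition_le pi lt; rewrite !entE /=; lia.
Qed.

(** The path is rebuilt from right to left. From the hit column J on it is its deletion; in column
    J-1 it has one more box, in the first empty row; further left the deletion is the row below, and
    [low_next] applies. *)
Lemma del_inj h A B : (h < N)%N -> box_path h A -> box_path h B -> A N = 0 -> B N = 0 ->
  agree h.+1 (del h A) (del h B) ->
  (forall c, (h.+1 < c <= N)%N -> hit h A c = hit h B c) -> agree h A B.
Proof.
move=> hN pA pB AN BN dAB hitAB.
(* Whether there is a first point is seen from the existence of a hit. *)
have zero : (A h.+1 == 0) = (B h.+1 == 0).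
  apply/idP/idP; apply: contraLR.
    move=> /(exists_hit hN pB BN)[J hJ]; rewrite -hitAB //; exact: hit_nonzero.
  move=> /(exists_hit hN pA AN)[J hJ]; rewrite hitAB //; exact: hit_nonzero.
have Ah : A h = B h by case: pA pB => -> _ _ [-> _ _].
move=> c hc; have [->//|ch] := eqVneq c h; have {ch}hc : (h < c <= N)%N by lia.
have [A1|A1] := eqVneq (A h.+1) 0.
  have B1 : B h.+1 = 0 by apply/eqP; rewrite -zero A1.
  by rewrite -(del_stay pA A1) // -(del_stay pB B1) // dAB.
have B1 : B h.+1 != 0 by rewrite -zero.
have [J hJ hitA] := exists_hit hN pA AN A1; have hitB := hitA; rewrite hitAB // in hitB.
have eJ : J = J.-1.+1 by lia.
have hJ' : (h < J.-1 < N)%N by lia.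
move/andP: hitA => [lA nA]; move/andP: hitB => [lB nB].
have high d : (J <= d <= N)%N -> A d = B d.
  move=> hd; have := dAB d; rewrite /del.
  have -> : low h A d = false by apply: contraNF nA; apply: (low_le pA); lia.
  have -> : low h B d = false by apply: contraNF nB; apply: (low_le pB); lia.
  by apply; lia.
have lowA d : (h < d < J)%N -> low h A d by move=> hd; apply: (low_le pA) lA; lia.
have lowB d : (h < d < J)%N -> low h B d by move=> hd; apply: (low_le pB) lB; lia.
have SAB d : (h < d < J)%N -> slide h A d = slide h B d.
  by move=> hd; have := dAB d; rewrite /del lowA // lowB //; apply; lia.
have AJ : A J = B J by apply: high; lia.
have AJ' : A J.-1 = B J.-1.
  rewrite eJ in nA nB AJ.
  have [x [_ _ Ax Ax0]] := hit_next pA A1 hJ' lA nA.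
  have [y [_ _ By By0]] := hit_next pB B1 hJ' lB nB.
  rewrite Ax By AJ; rewrite AJ in Ax Ax0; congr (_ + e _).
  apply: (first_empty_row _ _ Ax0 By0); rewrite -?Ax -?By.
    by case: pA => _ p _; apply: p; lia.
  by case: pB => _ p _; apply: p; lia.
have [Jc|cJ] := leqP J c; first by apply: high; lia.
elim: {c}(J.-1 - c)%N {-2}c (leqnn (J.-1 - c)%N) hc cJ => [|d IHd] c dc hc cJ.
  by have -> : c = J.-1 by lia.
have [->//|cJ'] := eqVneq c J.-1.
have hc' : (h < c < N)%N by lia.
rewrite -(low_next pA A1 hc') ?lowA //; try lia.
rewrite -(low_next pB B1 hc') ?lowB //; try lia.
by rewrite IHd ?SAB //; lia.
Qed.

Theorem rows_weight_inj mu nu : box_path 0 mu -> box_path 0 nu -> mu N = 0 -> nu N = 0 ->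
  (forall h c, (h <= c <= N)%N -> weight (rows mu h c) = weight (rows nu h c)) ->
  agree 0 mu nu.
Proof.
move=> pm pn mN nN wE.
(* The sizes of two consecutive rows decide where the upper one is low, hence its hits, which are
   also those of the residue. *)
have hitE h c : (h.+1 < c <= N)%N -> hit h (residue mu h) c = hit h (residue nu h) c.
  move=> hc; rewrite -!hit_rows // /hit /low.
  by have wS := wE h.+1; rewrite /= in wS; rewrite !wE ?wS //; lia.
(* The induction starts with residue N, compared only in column N, where both values are 0. *)
suff res h : (h <= N)%N -> agree (N - h) (residue mu (N - h)) (residue nu (N - h)).
  by have := res N (leqnn N); rewrite subnn.
elim: h => [|h IHh] hN.
  rewrite subn0 => c hc; have -> : c = N by lia.
  by rewrite !residue_end.
have eh : (N - h = (N - h.+1).+1)%N by lia.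
have hN' : (N - h.+1 < N)%N by lia.
apply: del_inj; rewrite ?residue_end //; try by [lia|apply: box_path_residue => //; lia].
  have := IHh (ltnW hN); rewrite {1 2 3}eh /=; exact.
by move=> c hc; apply: hitE.
Qed.

End Reconstruction.

(** * Two by two blocks *)

Section Blocks.
Variable r : nat.
Implicit Types (x y lam kap nu mu : 'rV[int]_r) (a b i j k : 'I_r).
Local Notation e := (@unit_vec r).
Local Notation one := (const_mx 1 : 'rV[int]_r).

(* The entries of odd index of the two embeddings, between lam *+ 2 and mu *+ 2. *)
Definition mid_O lam mu := if lam == mu then mu *+ 2 - last_unit r else lam + mu.

Definition mid_F lam mu :=
  if lam == mu then lam *+ 2 + one - last_unit r *+ 2
  else if adds_box lam mu then lam *+ 2 + one else mu *+ 2 + one.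

Lemma oneE k : one 0 k = 1.
Proof. by rewrite mxE. Qed.

Lemma doublevE x k : (x *+ 2) 0 k = x 0 k + x 0 k.
Proof. by rewrite mulr2n mxE. Qed.

Lemma add_box_neq x a : (x == x + e a) = false.
Proof. by apply/eqP => /(congr1 (@weight r)); rewrite weightD weight_unit; lia. Qed.

Lemma adds_boxE x a : adds_box x (x + e a).
Proof. by apply/existsP; exists a. Qed.

Lemma adds_boxN x a : adds_box (x + e a) x = false.
Proof.
apply/existsP => -[b /eqP/(congr1 (@weight r))].
by rewrite !weightD !weight_unit; lia.
Qed.

Lemma mid_O_up lam a : mid_O lam (lam + e a) = lam *+ 2 + e a.
Proof. by rewrite /mid_O add_box_neq mulr2n addrA. Qed.

Lemma mid_O_down lam a : mid_O (lam + e a) lam = lam *+ 2 + e a.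
Proof. by rewrite /mid_O eq_sym add_box_neq mulr2n addrAC. Qed.

Lemma mid_F_up lam a : mid_F lam (lam + e a) = lam *+ 2 + one.
Proof. by rewrite /mid_F add_box_neq adds_boxE. Qed.

Lemma mid_F_down lam a : mid_F (lam + e a) lam = lam *+ 2 + one.
Proof. by rewrite /mid_F eq_sym add_box_neq adds_boxN. Qed.

Lemma mid_O_stay lam : mid_O lam lam = lam *+ 2 - last_unit r.
Proof. by rewrite /mid_O eqxx. Qed.

Lemma mid_F_stay lam : mid_F lam lam = lam *+ 2 + one - last_unit r *+ 2.
Proof. by rewrite /mid_F eqxx. Qed.

Definition midE := (mid_O_up, mid_O_down, mid_F_up, mid_F_down, mid_O_stay, mid_F_stay).

Definition vac_step x y :=
  [\/ exists a, y = x + e a, exists a, x = y + e a | x = y /\ forall i, 0 < x 0 i].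

Lemma vac_step_sym x y : vac_step x y -> vac_step y x.
Proof.
case=> [h|h|[-> h]]; [by constructor 2|by constructor 1|by constructor 3].
Qed.

Lemma mid_O_sym x y : vac_step x y -> mid_O x y = mid_O y x.
Proof. by case=> [[a ->]|[a ->]|[-> _]] //; rewrite !midE. Qed.

Lemma mid_F_sym x y : vac_step x y -> mid_F x y = mid_F y x.
Proof. by case=> [[a ->]|[a ->]|[-> _]] //; rewrite !midE. Qed.

(** Sorting in a cell with filling 0. *)
Definition sorts x y := dom x = y /\ forall k, 0 <= x 0 k.

Lemma sorts_id x y : is_partition y -> x = y -> sorts x y.
Proof. by move=> py ->; split; [apply: dom_id|move=> k; apply: partition_ge0]. Qed.

Lemma sorts_swap a b x y : is_partition y -> x 0 a = y 0 b -> x 0 b = y 0 a ->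
  (forall k, k != a -> k != b -> x 0 k = y 0 k) -> sorts x y.
Proof.
move=> py xa xb xk; split=> [|k].
  by rewrite -[RHS]dom_id //; apply: dom_swap xa xb xk.
have [->|ka] := eqVneq k a; first by rewrite xa partition_ge0.
have [->|kb] := eqVneq k b; first by rewrite xb partition_ge0.
by rewrite xk // partition_ge0.
Qed.

(** Corners 2 lam and 2 nu above, 2 kap and 2 mu below, centre z, values of [mid] at the middles of
    the sides. Only the upper right and the lower left cell may be filled; the vectors in the other
    two have no negative entry. *)
Definition block (mid : 'rV[int]_r -> 'rV[int]_r -> 'rV[int]_r) lam kap nu mu :=
  let z := dom (mid lam kap + mid lam nu - lam *+ 2) in
  [/\ forall k, 0 <= (mid lam kap + mid lam nu - lam *+ 2) 0 k,
      dom (z + nu *+ 2 - mid lam nu) = mid nu mu,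
      dom (kap *+ 2 + z - mid lam kap) = mid kap mu &
      sorts (mid kap mu + mid nu mu - z) (mu *+ 2)].

Lemma block_sym mid lam kap nu mu : block mid lam kap nu mu -> block mid lam nu kap mu.
Proof.
move=> [h1 h2 h3 h4]; rewrite /block [mid lam nu + mid lam kap]addrC; split=> //.
- by rewrite [_ + kap *+ 2]addrC.
- by rewrite [nu *+ 2 + _]addrC.
- by rewrite [mid nu mu + _]addrC.
Qed.

Lemma blockI mid lam kap nu mu m1 m2 z m3 m4 :
  mid lam kap = m1 -> mid lam nu = m2 -> mid nu mu = m3 -> mid kap mu = m4 ->
  sorts (m1 + m2 - lam *+ 2) z -> dom (z + nu *+ 2 - m2) = m3 ->
  dom (kap *+ 2 + z - m1) = m4 -> sorts (m4 + m3 - z) (mu *+ 2) ->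
  block mid lam kap nu mu.
Proof. by rewrite /block => -> -> -> -> [-> ?] ? ? ?. Qed.

Lemma dom_eq x y : is_partition y -> x = y -> dom x = y.
Proof. by move=> py ->; apply: dom_id. Qed.

Lemma dom_flip a x y : is_partition y -> x 0 a = - y 0 a ->
  (forall k, k != a -> x 0 k = y 0 k) -> dom x = y.
Proof.
move=> py xa xk; rewrite -[RHS]dom_id //; apply: dom_abs => k.
by have [->|/xk->//] := eqVneq k a; rewrite xa normrN.
Qed.

End Blocks.

Ltac ents := rewrite ?(doublevE, addvE, oppvE, unit_vecE, oneE) /=.
Ltac veq := let k := fresh "k" in apply/rowP => k; ents; clear; lia.
Ltac ppart :=
  let i := fresh "i" in let j := fresh "j" in let ij := fresh "ij" in
  apply/is_partitionP; split=> [i|i j ij];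
  [ repeat match goal with
    | H : is_true (is_partition _) |- _ => move: (partition_ge0 i H); clear H
    | H : forall k : ordinal _, is_true (0 < _)%R |- _ => move: (H i); clear H
    | H : is_true (~~ (_ == _)) |- _ => apply ord_neq in H
    end
  | have jr := ltn_ord j; repeat match goal with
    | H : is_true (is_partition _) |- _ => move: (partition_le H ij); clear H
    | H : forall k : ordinal _, is_true (0 < _)%R |- _ => move: (H i) (H j); clear H
    | H : is_true (~~ (_ == _)) |- _ => apply ord_neq in H
    end];
  ents; lia.

(** [sI] and [dI] check that nothing has to be sorted, [sS a b] and [dS a b] that sorting exchanges
    entries a and b, [dF a] that it only changes the sign of entry a. *)
Ltac sI := apply: sorts_id; [ppart|veq].
Ltac dI := apply: dom_eq; [ppart|veq].
Ltac hents := repeat match goal with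
  | H : @eq _ (fun_of_matrix (_ + _)%R _ _) _ |- _ => rewrite !entE in H
  end.
Ltac sS a b := hents; refine (@sorts_swap _ a b _ _ _ _ _ _);
  [ppart|ents; lia|ents; lia|
   let k := fresh "k" in let ka := fresh "ka" in let kb := fresh "kb" in
   intros k ka kb; apply ord_neq in ka; apply ord_neq in kb; ents; lia].
Ltac dS a b := refine (proj1 (_ : sorts _ _)); sS a b.
Ltac dF a := refine (@dom_flip _ a _ _ _ _ _);
  [ppart|ents; lia|
   let k := fresh "k" in let ka := fresh "ka" in
   intros k ka; apply ord_neq in ka; ents; lia].

(** * Completing a block of vacillating tableaux from three corners *)

Section VBlock.
Variable r : nat.
Implicit Types (x y lam kap nu mu : 'rV[int]_r) (a b i j k : 'I_r).
Local Notation e := (@unit_vec r).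
Local Notation one := (const_mx 1 : 'rV[int]_r).

(** The same fourth corner mu serves for O and F, so both matrices agree above the diagonal. The
    lemmas below are sorted by the steps from lam to kap and nu: up, down or stay. *)
Definition vac_block lam kap nu := exists mu,
  [/\ is_partition mu, vac_step kap mu, vac_step nu mu,
      block (@mid_O r) lam kap nu mu & block (@mid_F r) lam kap nu mu].

Lemma vac_block_sym lam kap nu : vac_block lam kap nu -> vac_block lam nu kap.
Proof.
move=> [mu [pm sk sn bO bF]]; exists mu.
by split; [exact: pm|exact: sn|exact: sk|exact: block_sym bO|exact: block_sym bF].
Qed.

Lemma vac_block_UU_neq lam a b : a != b -> is_partition lam ->
  is_partition (lam + e a) -> is_partition (lam + e b) ->
  vac_block lam (lam + e a) (lam + e b).
Proof.
move=> nab pl pa pb; have eab : lam + e a + e b = lam + e b + e a by rewrite addrAC.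
exists (lam + e a + e b); split.
- ppart.
- by constructor 1; exists b.
- by constructor 1; exists a.
- apply: (@blockI _ _ _ _ _ _ _ _ (lam *+ 2 + e a + e b)).
  1,2,4: by rewrite midE.
  + by rewrite eab midE.
  + sI.
  + dI.
  + dI.
  + sI.
- apply: (@blockI _ _ _ _ _ _ _ _ (lam *+ 2 + one + one)).
  1,2,4: by rewrite midE.
  + by rewrite eab midE.
  + sI.
  + dI.
  + dI.
  + sI.
Qed.

(** The second box goes to the first row p that is as long as row a of nu + e a. *)
Lemma vac_block_UU_eq nu a : is_partition nu -> is_partition (nu + e a) ->
  vac_block nu (nu + e a) (nu + e a).
Proof.
move=> pl pn; have [p [pa np pm _]] := dom_add a pn.
exists (nu + e a + e p); split=> //; try by constructor 1; exists p.
- apply: (@blockI _ _ _ _ _ _ _ _ ((nu + e a) *+ 2)).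
  1-4: by rewrite midE.
  + sI.
  + dS a p.
  + dS a p.
  + sI.
- apply: (@blockI _ _ _ _ _ _ _ _ (nu *+ 2 + one + one)).
  1-4: by rewrite midE.
  + sI.
  + dI.
  + dI.
  + sS a p.
Qed.

(** If row a of nu can take a box, the two steps commute. Otherwise sorting moves that box to row b,
    and mu is lam again. *)
Lemma vac_block_UD nu a b : is_partition nu -> is_partition (nu + e b) ->
  is_partition (nu + e b + e a) -> vac_block (nu + e b) (nu + e b + e a) nu.
Proof.
move=> pn pl pk; have [p [pa np pm _]] := dom_add a pn.
have [epa|npa] := eqVneq p a.
  subst p; have eab : nu + e b + e a = nu + e a + e b by rewrite addrAC.
  exists (nu + e a); split=> //; try by constructor 1; exists a.
  - by constructor 2; exists b.
  - apply: (@blockI _ _ _ _ _ _ _ _ (nu *+ 2 + e a + e b)).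
    1-3: by rewrite midE.
    + by rewrite eab midE.
    + sI.
    + dI.
    + dI.
    + sI.
  - apply: (@blockI _ _ _ _ _ _ _ _ (nu *+ 2 + one + one)).
    1-3: by rewrite midE.
    + by rewrite eab midE.
    + sI.
    + dI.
    + dI.
    + sI.
have pb : p = b.
  have enu : nu = nu + e b - e b by rewrite addrK.
  exact: (top_neq_small pk enu pa np npa).
subst p; exists (nu + e b); split=> //.
- by constructor 2; exists a.
- by constructor 1; exists b.
- apply: (@blockI _ _ _ _ _ _ _ _ (nu *+ 2 + e a + e b)).
  1-4: by rewrite midE.
  + sI.
  + dS a b.
  + dS a b.
  + sI.
- apply: (@blockI _ _ _ _ _ _ _ _ (nu *+ 2 + one + one)).
  1-4: by rewrite midE.
  + sI.
  + dI.
  + dS a b.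
  + sI.
Qed.

Lemma vac_block_DD_neq mu a b : a != b -> is_partition (mu + e a + e b) ->
  is_partition (mu + e a) -> is_partition (mu + e b) ->
  vac_block (mu + e a + e b) (mu + e b) (mu + e a).
Proof.
move=> nab pl pn pk; have eab : mu + e a + e b = mu + e b + e a by rewrite addrAC.
have pm : is_partition mu by ppart.
exists mu; split=> //; try by constructor 2; eexists.
- apply: (@blockI _ _ _ _ _ _ _ _ (mu *+ 2 + e a + e b)).
  1: by rewrite eab midE.
  1-3: by rewrite midE.
  + sI.
  + dI.
  + dI.
  + sI.
- apply: (@blockI _ _ _ _ _ _ _ _ (mu *+ 2 + one + one)).
  1: by rewrite eab midE.
  1-3: by rewrite midE.
  + sI.
  + dI.
  + dI.
  + sI.
Qed.

Variable l : 'I_r.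
Hypothesis l_last : l.+1 = r.

Lemma last_unitE : last_unit r = e l.
Proof. by apply/rowP => k; rewrite unit_vecE mxE -{2}l_last eqSS; case: eqP. Qed.

(** If row a of nu is empty, the second removal turns into an addition and mu is lam. Otherwise mu
    loses a box in the last row as long as row a of nu. *)
Lemma vac_block_DD_eq nu a : is_partition nu -> is_partition (nu + e a) ->
  vac_block (nu + e a) nu nu.
Proof.
move=> pn pl; have [na|na] := eqVneq (nu 0 a) 0.
  have nl : nu 0 l = 0.
    have := partition_ge0 l pn; have [<- //|nal] := eqVneq a l.
    have al : (a < l)%N.
      by have := ltn_ord a; move: nal; rewrite -val_eqE /=; clear - l_last; lia.
    by have := partition_le pn al; lia.
  exists (nu + e a); split=> //; try by constructor 1; exists a.
  - apply: (@blockI _ _ _ _ _ _ _ _ (nu *+ 2)).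
    1-4: by rewrite midE.
    + sI.
    + dF a.
    + dF a.
    + sI.
  (* Rows a to l of nu are empty, so sorting moves the two missing units of the centre from row a to
     the last row. *)
  - apply: (@blockI _ _ _ _ _ _ _ _ (nu *+ 2 + one + one - e l - e l)).
    1-4: by rewrite midE.
    + sS a l.
    + dF l.
    + dF l.
    + sS a l.
have {}na : 0 < nu 0 a by have := partition_ge0 a pn; lia.
have [q [aq nq pm _]] := dom_sub pn na.
have eq : nu = nu - e q + e q by rewrite subrK.
exists (nu - e q); split=> //; try by constructor 2; exists q.
- apply: (@blockI _ _ _ _ _ _ _ _ (nu *+ 2)).
  1,2: by rewrite midE.
  1,2: by rewrite {1}eq midE.
  + sI.
  + dS a q.
  + dS a q.
  + sI.
- apply: (@blockI _ _ _ _ _ _ _ _ (nu *+ 2 + one + one - e q - e q)).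
  1,2: by rewrite midE.
  1,2: by rewrite {1}eq midE.
  + sS a q.
  + dI.
  + dI.
  + sI.
Qed.

Lemma vac_block_stay_up lam b : is_partition lam -> (forall i, 0 < lam 0 i) ->
  is_partition (lam + e b) -> vac_block lam lam (lam + e b).
Proof.
move=> pl lpos pn; exists (lam + e b); split=> //.
- by constructor 1; exists b.
- by constructor 3; split=> // i; have := lpos i; ents; lia.
- apply: (@blockI _ _ _ _ _ _ _ _ (lam *+ 2 + e b - e l)).
  1-4: by rewrite midE ?last_unitE.
  + sI.
  + dI.
  + dI.
  + sI.
- apply: (@blockI _ _ _ _ _ _ _ _ (lam *+ 2 + one + one - e l - e l)).
  1-4: by rewrite midE ?last_unitE.
  + sI.
  + dI.
  + dI.
  + sI.
Qed.

Lemma vac_block_stay lam : is_partition lam -> (forall i, 0 < lam 0 i) ->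
  vac_block lam lam lam.
Proof.
move=> pl lpos; exists lam; split=> //; try by constructor 3.
- apply: (@blockI _ _ _ _ _ _ _ _ (lam *+ 2 - e l - e l)).
  1-4: by rewrite midE ?last_unitE.
  + sI.
  + dI.
  + dI.
  + sI.
- apply: (@blockI _ _ _ _ _ _ _ _ (lam *+ 2 + one + one - (e l *+ 2) *+ 2)).
  1-4: by rewrite midE ?last_unitE.
  + sI.
  + dI.
  + dI.
  + sI.
Qed.

(** If nu has only positive parts, the two steps commute. Otherwise the removed box was the only one
    in the last row, nu may not be repeated, and mu is lam. *)
Lemma vac_block_stay_down nu b : is_partition nu -> is_partition (nu + e b) ->
  (forall i, 0 < (nu + e b) 0 i) -> vac_block (nu + e b) (nu + e b) nu.
Proof.
move=> pn pl lpos; have [/forallP nu_gt0|] := boolP [forall i, 0 < nu 0 i].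
  have npos i : 0 < nu 0 i by apply: nu_gt0.
  clear nu_gt0; exists nu; split=> //.
  - by constructor 2; exists b.
  - by constructor 3.
  - apply: (@blockI _ _ _ _ _ _ _ _ (nu *+ 2 + e b - e l)).
    1-4: by rewrite midE ?last_unitE.
    + sI.
    + dI.
    + dI.
    + sI.
  - apply: (@blockI _ _ _ _ _ _ _ _ (nu *+ 2 + one + one - e l - e l)).
    1-4: by rewrite midE ?last_unitE.
    + sI.
    + dI.
    + dI.
    + sI.
rewrite negb_forall => /existsP[i ni].
have nl : nu 0 l = 0.
  have := partition_ge0 l pn; have [<-|nil] := eqVneq i l; first by lia.
  have il : (i < l)%N.
    by have := ltn_ord i; move: nil; rewrite -val_eqE /=; clear - l_last; lia.
  by have := partition_le pn il; lia.
have bl : b = l by apply: val_inj => /=; have := lpos l; ents; lia.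
subst b; exists (nu + e l); split=> //.
- by constructor 3.
- by constructor 1; exists l.
- apply: (@blockI _ _ _ _ _ _ _ _ (nu *+ 2)).
  1-4: by rewrite midE ?last_unitE.
  + sI.
  + dF l.
  + dI.
  + sI.
- apply: (@blockI _ _ _ _ _ _ _ _ (nu *+ 2 + one + one - e l - e l)).
  1-4: by rewrite midE ?last_unitE.
  + sI.
  + dF l.
  + dI.
  + sI.
Qed.

End VBlock.

(** * Sizes and fillings *)

Section Weights.
Variable r : nat.
Implicit Types (x y z lam kap nu mu : 'rV[int]_r) (i j k : 'I_r).
Local Notation e := (@unit_vec r).

Lemma weight_double x : weight (x *+ 2) = weight x + weight x.
Proof. by rewrite mulr2n weightD. Qed.

Lemma weight_dom x : weight (dom x) = \sum_i `|x 0 i|.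
Proof.
rewrite /weight; set s := [seq `|x 0 j| | j <- enum 'I_r].
have ss : seq.size (sort >=%R s) = r by rewrite size_sort size_map size_enum_ord.
transitivity (\sum_(0 <= i < r) nth 0 (sort >=%R s) i).
  by rewrite big_mkord; apply: eq_bigr => i _; rewrite mxE.
rewrite -{1}ss -(big_nth 0 predT id) (perm_big s) ?perm_sort //=.
by rewrite big_map big_enum.
Qed.

Lemma dom_ge0 x i : 0 <= dom x 0 i.
Proof.
rewrite mxE; set s := sort _ _; have [lt|ge] := ltnP i (seq.size s); last by rewrite nth_default.
have /mapP[j _ ->] : nth 0 s i \in [seq `|x 0 j| | j <- enum 'I_r].
  by rewrite -(mem_sort >=%R) mem_nth.
exact: normr_ge0.
Qed.

Lemma Phi_F_sum x : Posz (Phi_F x) = \sum_i Posz (x 0 i < 0)%R.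
Proof.
rewrite /Phi_F -sum1dep_card big_mkcond (big_morph Posz PoszD erefl).
by apply: eq_bigr => i _; case: ifP.
Qed.

(** Each negative entry is -1 and contributes 1 after sorting. *)
Lemma weight_dom_F x : (forall i, -1 <= x 0 i) ->
  weight (dom x) = weight x + Posz (Phi_F x) + Posz (Phi_F x).
Proof.
move=> xge; rewrite weight_dom Phi_F_sum -!big_split; apply: eq_bigr => i _ /=.
have := xge i; case: ltrP => xi xi1 /=; [rewrite ltr0_norm|rewrite ger0_norm] => //; lia.
Qed.

Lemma Phi_O_F x : (forall i j, x 0 i < 0 -> x 0 j < 0 -> i = j) -> Phi_O x = Phi_F x.
Proof.
move=> x1; rewrite /Phi_O /Phi_F; case: existsP => [[i xi]|nx].
  suff -> : [set j | x 0 j < 0] = [set i] by rewrite cards1.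
  by apply/setP=> j; rewrite !inE; apply/idP/eqP => [xj|->//]; apply: x1.
suff -> : [set j | x 0 j < 0] = set0 by rewrite cards0.
by apply/setP=> j; rewrite !inE; apply/negP => xj; apply: nx; exists j.
Qed.

(* A negative entry -1 becomes 1 in [dom], so that every cell changes the size by twice its
   filling; for O this needs that at most one entry is negative. *)
Definition fills (mid : 'rV[int]_r -> 'rV[int]_r -> 'rV[int]_r) (Phi : 'rV[int]_r -> nat) :=
  (forall x, (forall i, 0 <= x 0 i) -> Phi x = 0%N) /\
  (forall lam nu z, vac_step lam nu -> (forall i, 0 <= z 0 i) ->
    let x := z + nu *+ 2 - mid lam nu in
    weight (dom x) = weight x + Posz (Phi x) + Posz (Phi x)).

Lemma Phi_F_ge0 x : (forall i, 0 <= x 0 i) -> Phi_F x = 0%N.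
Proof.
by move=> x0; apply: eq_card0 => i; rewrite inE; apply/negbTE; have := x0 i; lia.
Qed.

Lemma weight_dom_ge0 x : (forall i, 0 <= x 0 i) -> weight (dom x) = weight x.
Proof. by move=> x0; rewrite weight_dom; apply: eq_bigr => i _; rewrite ger0_norm. Qed.

(** Two cells are empty and the other two raise the size by twice their filling. In the sum of the
    four size equations the centre and the values of [mid] cancel, which leaves twice the claim. *)
Lemma fills_block (mid : 'rV[int]_r -> 'rV[int]_r -> 'rV[int]_r) Phi
    lam kap nu mu (z := dom (mid lam kap + mid lam nu - lam *+ 2)) :
  fills mid Phi -> vac_step lam kap -> vac_step lam nu -> block mid lam kap nu mu ->
  Posz (addn (addn (Phi (mid lam kap + mid lam nu - lam *+ 2)) (Phi (kap *+ 2 + z - mid lam kap)))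
             (addn (Phi (z + nu *+ 2 - mid lam nu)) (Phi (mid kap mu + mid nu mu - z)))) =
  weight mu + weight lam - weight kap - weight nu.
Proof.
move=> [Phi0 cellE] sk sn [nn e2 e3 [e4 nn4]].
have z0 := dom_ge0 (mid lam kap + mid lam nu - lam *+ 2).
have := cellE _ _ _ sn z0; have := cellE _ _ _ sk z0.
cbv zeta; rewrite -/z in e2 e3 e4 nn4 *.
rewrite [z + kap *+ 2]addrC e2 e3 (Phi0 _ nn) (Phi0 _ nn4).
have := weight_dom_ge0 nn; have := weight_dom_ge0 nn4; rewrite e4 -/z.
rewrite ?(weightD, weightN, weight_double) /= add0n addn0 PoszD.
move: (Phi _) (Phi _) (weight (mid kap mu)) (weight (mid nu mu)) (weight (mid lam kap))
  (weight (mid lam nu)) (weight z) (weight lam) (weight kap) (weight nu) (weight mu).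
lia.
Qed.

Variable l : 'I_r.
Hypothesis l_last : l.+1 = r.

(** 2 nu minus [mid_O lam nu] is a unit vector up to sign, so at most one entry becomes negative,
    and [Phi_O] agrees with [Phi_F] there. *)
Lemma fills_O : fills (@mid_O r) (@Phi_O r).
Proof.
split=> [x x0|lam nu z st z0 x].
  by rewrite Phi_O_F ?Phi_F_ge0 // => i j; have := x0 i; lia.
suff [a x1] : exists a, forall i, -1 <= x 0 i /\ (x 0 i < 0 -> i = a).
  rewrite Phi_O_F; first by apply: weight_dom_F => i; have [] := x1 i.
  by move=> i j /(x1 i).2 -> /(x1 j).2 ->.
rewrite /x; case: st => [[a ->]|[a ->]|[-> _]]; rewrite midE ?(last_unitE l_last).
- exists a => i; have := z0 i; ents => zi; split; first by lia.
  by move=> h; apply: val_inj => /=; lia.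
- exists a => i; have := z0 i; ents => zi; split; first by lia.
  by move=> h; apply: val_inj => /=; lia.
- exists l => i; have := z0 i; ents => zi; split; first by lia.
  by move=> h; apply: val_inj => /=; lia.
Qed.

Lemma fills_F : fills (@mid_F r) (@Phi_F r).
Proof.
split=> [x|lam nu z st z0 x]; first exact: Phi_F_ge0.
apply: weight_dom_F => i; have := z0 i; rewrite /x.
by case: st => [[a ->]|[a ->]|[-> _]]; rewrite midE ?(last_unitE l_last); ents; lia.
Qed.

Lemma vac_blockP lam kap nu : is_partition lam -> is_partition kap -> is_partition nu ->
  vac_step lam kap -> vac_step lam nu -> vac_block lam kap nu.
Proof.
move=> pl pk pn [[a ek]|[a ek]|[ek kpos]] [[b en]|[b en]|[en npos]].
- subst kap nu; have [<-|ab] := eqVneq a b; first exact: vac_block_UU_eq.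
  exact: vac_block_UU_neq.
- by subst kap lam; apply: vac_block_UD.
- by subst kap nu; apply: vac_block_sym; apply: (vac_block_stay_up l_last).
- by subst nu lam; apply: vac_block_sym; apply: vac_block_UD.
- have [ab|ab] := eqVneq a b.
    have ekn : kap = nu by apply: (addIr (e a)); rewrite -ek en ab.
    by subst nu lam; apply: (vac_block_DD_eq l_last).
  have ek' : kap = kap - e b + e b by rewrite subrK.
  have en' : nu = kap - e b + e a by rewrite addrAC -ek en addrK.
  have el : lam = kap - e b + e a + e b by rewrite -en' en.
  by rewrite el {2}ek' {1}en'; apply: vac_block_DD_neq; rewrite -?el -?en' -?ek'.
- by subst nu lam; apply: vac_block_sym; apply: (vac_block_stay_down l_last).
- by subst kap nu; apply: (vac_block_stay_up l_last).
- by subst kap lam; apply: (vac_block_stay_down l_last).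
- by subst kap nu; apply: (vac_block_stay l_last).
Qed.

(** The sizes of lam and nu tell whether the step goes up, goes down or stays. *)
Lemma weight_mid_O lam nu lam' nu' : vac_step lam nu -> vac_step lam' nu' ->
  weight lam = weight lam' -> weight nu = weight nu' ->
  weight (mid_O lam nu) = weight (mid_O lam' nu').
Proof.
case=> [[a ->]|[a ->]|[-> _]] [[b ->]|[b ->]|[-> _]]; rewrite !midE ?(last_unitE l_last);
  rewrite ?(weightE, weight_double); lia.
Qed.

End Weights.

(** * Promotion of vacillating tableaux *)

Section Promotion.
Variable r : nat.
Implicit Types (f mu nu : nat -> 'rV[int]_r) (c d k m n : nat).
Local Notation e := (@unit_vec r).

Lemma growth_rowS (x0 : 'rV[int]_r) nu c : (2 <= c)%N ->
  growth_row x0 nu c.+1 = dom (growth_row x0 nu c + nu c.+1 - nu c).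
Proof. by move=> /= ->. Qed.

Lemma growth_row_eq (x0 : 'rV[int]_r) mu nu c : (forall d, (d <= c)%N -> mu d = nu d) ->
  growth_row x0 mu c = growth_row x0 nu c.
Proof.
elim: c => [|c IHc] //= eqd; rewrite !eqd ?IHc //; try lia.
by move=> d dc; apply: eqd; lia.
Qed.

Lemma row_a_eq mu nu c : (0 < c)%N -> (forall d, (d <= c)%N -> mu d = nu d) ->
  row_a mu c = row_a nu c.
Proof. by move=> c0 eqd; rewrite /row_a eqd; [apply: growth_row_eq|lia]. Qed.

Lemma row_b_eq mu nu c : (0 < c)%N -> (forall d, (d <= c)%N -> mu d = nu d) ->
  row_b mu c = row_b nu c.
Proof.
move=> c0 eqd; apply: growth_row_eq => -[|d] dc; last first.
  by apply: row_a_eq => // d' h; apply: eqd; lia.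
by rewrite /row_a /= eqd //; lia.
Qed.

Lemma column_filling_eq Phi mu nu c : (1 < c)%N -> (forall d, (d <= c)%N -> mu d = nu d) ->
  column_filling Phi mu c = column_filling Phi nu c.
Proof.
move=> c1 eqd; have eqd' d : (d <= c.-1)%N -> mu d = nu d by move=> h; apply: eqd; lia.
by rewrite /column_filling !(row_a_eq _ eqd) ?(row_a_eq _ eqd') ?(row_b_eq _ eqd') ?eqd //; lia.
Qed.

(** Common form of the two embeddings; for [nth 0 V] it unfolds to [iota_VO] or [iota_VF]. *)
Definition embed (mid : 'rV[int]_r -> 'rV[int]_r -> 'rV[int]_r) f d : 'rV[int]_r :=
  if ~~ odd d then f (uphalf d) *+ 2 else mid (f (uphalf d).-1) (f (uphalf d)).

Lemma embed_even mid f k : embed mid f (2 * k) = f k *+ 2.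
Proof. by rewrite /embed mul2n odd_double uphalf_double. Qed.

Lemma embed_odd mid f k : embed mid f (2 * k).+1 = mid (f k) (f k.+1).
Proof. by rewrite /embed mul2n /= odd_double /= doubleK. Qed.

(** Nothing is required at the end: each promotion step is followed on a path shorter by one, which
    suffices for the entries above the diagonal. *)
Definition vac_path m f :=
  [/\ f 0%N = 0, forall k, (k <= m)%N -> is_partition (f k) &
      forall k, (k < m)%N -> vac_step (f k) (f k.+1)].

Definition halfv (x : 'rV[int]_r) : 'rV[int]_r := map_mx (fun v => (v %/ 2)%Z) x.

Lemma halfv_double x : halfv (x *+ 2) = x.
Proof. by apply/rowP => k; rewrite mxE doublevE; lia. Qed.

(* Defined through the embedding in O; the embedding in F gives the same path. *)
Definition vac_promotion f k := halfv (row_b (embed (@mid_O r) f) (2 * k).+2).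

Lemma embed_rows mid f k (kap mu : 'rV[int]_r) (F := embed mid f) (lam := f k.+1) (nu := f k.+2)
    (z := dom (mid lam kap + mid lam nu - lam *+ 2)) :
  block mid lam kap nu mu ->
  row_a F (2 * k).+2 = mid lam kap -> row_b F (2 * k).+2 = kap *+ 2 ->
  [/\ row_a F (2 * k).+3 = z, row_a F (2 * k).+4 = mid nu mu,
      row_b F (2 * k).+3 = mid kap mu & row_b F (2 * k).+4 = mu *+ 2].
Proof.
move=> [_ e2 e3 [e4 _]] ra rb.
have F2 : F (2 * k).+2 = lam *+ 2 by rewrite /F -(embed_even mid) mulnS.
have F3 : F (2 * k).+3 = mid lam nu by rewrite /F -embed_odd mulnS.
have F4 : F (2 * k).+4 = nu *+ 2 by rewrite /F -(embed_even mid) !mulnS.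
have ra3 : row_a F (2 * k).+3 = z by rewrite /row_a growth_rowS // -/(row_a F) ra F3 F2.
have ra4 : row_a F (2 * k).+4 = mid nu mu.
  by rewrite /row_a growth_rowS // -/(row_a F) ra3 F4 F3.
have rb3 : row_b F (2 * k).+3 = mid kap mu.
  by rewrite /row_b growth_rowS // -/(row_b F) rb ra3 ra.
by split=> //; rewrite /row_b growth_rowS // -/(row_b F) rb3 ra3 ra4.
Qed.

Definition embedding mid Phi :=
  (mid = @mid_O r /\ Phi = @Phi_O r) \/ (mid = @mid_F r /\ Phi = @Phi_F r).

Variable l : 'I_r.
Hypothesis l_last : l.+1 = r.

(** From 0 no box can be removed, and staying would need positive parts; [l] shows that there is a
    part. *)
Lemma vac_path_first m f : vac_path m.+1 f -> exists a : 'I_r, f 1%N = e a.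
Proof.
move=> [f0 pf sf]; have [[a]|[a]|[_ pos]] := sf 0%N isT; rewrite ?f0.
- by rewrite add0r => ->; exists a.
- move=> /(congr1 (@weight r)); rewrite weightD weight_unit weight0.
  by have := weight_ge0 (pf 1%N isT); lia.
- by have := pos l; rewrite f0 mxE.
Qed.

Section Step.
Variables (m : nat) (f : nat -> 'rV[int]_r).
Hypothesis vf : vac_path m.+1 f.
Let f' := vac_promotion f.

Lemma vac_promotion0 : f' 0%N = 0.
Proof. by rewrite /f' /vac_promotion /row_b /= -(mul0rn _ 2) halfv_double mul0rn. Qed.

Lemma mid_sym mid Phi x y : embedding mid Phi -> vac_step x y -> mid x y = mid y x.
Proof. by case=> [[-> _]|[-> _]]; [apply: mid_O_sym|apply: mid_F_sym]. Qed.

(** Block by block from left to right: the left side of block k has the corners given by [f k.+1]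
    and [f' k], and completing the block yields [f' k.+1], for both embeddings alike. *)
Lemma vac_promotion_rows k : (k <= m)%N ->
  [/\ is_partition (f' k), vac_step (f k.+1) (f' k) &
    forall mid Phi, embedding mid Phi ->
      row_a (embed mid f) (2 * k).+2 = mid (f k.+1) (f' k) /\
      row_b (embed mid f) (2 * k).+2 = f' k *+ 2] /\
  ((k < m)%N -> vac_step (f' k) (f' k.+1) /\
    forall mid Phi, embedding mid Phi -> block mid (f k.+1) (f' k) (f k.+2) (f' k.+1)).
Proof.
have [f0 pf sf] := vf; have eO : embedding (@mid_O r) (@Phi_O r) by left.
have next j : (j < m)%N -> [/\ is_partition (f' j), vac_step (f j.+1) (f' j) &
    forall mid Phi, embedding mid Phi ->
      row_a (embed mid f) (2 * j).+2 = mid (f j.+1) (f' j) /\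
      row_b (embed mid f) (2 * j).+2 = f' j *+ 2] ->
  [/\ is_partition (f' j.+1), vac_step (f j.+2) (f' j.+1), vac_step (f' j) (f' j.+1) &
     forall mid Phi, embedding mid Phi -> block mid (f j.+1) (f' j) (f j.+2) (f' j.+1)].
  move=> jm [pj sj rj].
  have [|||mu [pm sk sn bO bF]] :=
    vac_blockP l_last (pf j.+1 _) pj (pf j.+2 _) sj (sf j.+1 _); try lia.
  have -> : f' j.+1 = mu.
    have [ra rb] := rj _ _ eO; have [_ _ _ rb4] := embed_rows bO ra rb.
    by rewrite /f' /vac_promotion mulnS rb4 halfv_double.
  by split=> // mid Phi [[-> _]|[-> _]].
suff inv : (k <= m)%N -> [/\ is_partition (f' k), vac_step (f k.+1) (f' k) &
    forall mid Phi, embedding mid Phi ->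
      row_a (embed mid f) (2 * k).+2 = mid (f k.+1) (f' k) /\
      row_b (embed mid f) (2 * k).+2 = f' k *+ 2].
  by move=> km; split=> [|km']; [apply: inv|have [] := next k km' (inv km)].
elim: k => [|k IHk] km.
  have s1 : vac_step 0 (f 1%N) by rewrite -[X in vac_step X _]f0; apply: sf.
  rewrite vac_promotion0; split=> [||mid Phi mP]; first exact: is_partition0.
    exact: vac_step_sym.
  rewrite (mid_sym mP (vac_step_sym s1)) mul0rn; split=> //.
  by rewrite /row_a /= (embed_odd mid f 0) f0.
have [pk sk bk] := IHk (ltnW km); have [pm sn sm bm] := next k km (And3 pk sk bk).
split=> // mid Phi mP; have [ra rb] := bk _ _ mP.
by have [_ ra4 _ rb4] := embed_rows (bm _ _ mP) ra rb; rewrite mulnS.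
Qed.

Lemma vac_path_promotion : vac_path m f'.
Proof.
split=> [|k km|k km]; first exact: vac_promotion0.
  by have [[]] := vac_promotion_rows km.
by have [_ /(_ km)[]] := vac_promotion_rows (ltnW km).
Qed.

Variables (mid : 'rV[int]_r -> 'rV[int]_r -> 'rV[int]_r) (Phi : 'rV[int]_r -> nat).
Hypothesis mP : embedding mid Phi.
Let F := embed mid f.

Lemma row_a_even k : (k <= m)%N -> row_a F (2 * k).+2 = mid (f k.+1) (f' k).
Proof. by move=> km; have [[_ _ /(_ _ _ mP)[]]] := vac_promotion_rows km. Qed.

Lemma row_a_step k : (k <= m)%N -> vac_step (f k.+1) (f' k).
Proof. by move=> km; have [[]] := vac_promotion_rows km. Qed.

Lemma fills_mid : fills mid Phi.
Proof. by case: mP => [[-> ->]|[-> ->]]; [apply: (fills_O l_last)|apply: (fills_F l_last)]. Qed.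

Lemma row_a_odd k : (k < m)%N -> weight (row_a F (2 * k).+3) =
  weight (mid (f k.+1) (f' k)) + weight (mid (f k.+1) (f k.+2)) - weight (f k.+1 *+ 2).
Proof.
move=> km; have [[_ _ /(_ _ _ mP)[ra rb]] /(_ km)[_ /(_ _ _ mP) bk]] :=
  vac_promotion_rows (ltnW km).
have [-> _ _ _] := embed_rows bk ra rb; case: bk => nn _ _ _.
by rewrite weight_dom_ge0 // weightD weightN weightD.
Qed.

Lemma row_b_embed d : (d <= 2 * m)%N -> row_b F d.+2 = embed mid f' d.
Proof.
move=> dm; have [odd_d|even_d] := boolP (odd d); last first.
  have -> : d = (2 * d./2)%N by lia.
  have km : (d./2 <= m)%N by lia.
  have [[_ _ /(_ _ _ mP)[_ rb]] _] := vac_promotion_rows km.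
  by rewrite embed_even.
have -> : d = (2 * d./2).+1%N by lia.
have km : (d./2 < m)%N by lia.
have [[_ _ /(_ _ _ mP)[ra rb]] /(_ km)[_ /(_ _ _ mP) bk]] :=
  vac_promotion_rows (ltnW km).
by have [_ _ rb3 _] := embed_rows bk ra rb; rewrite embed_odd.
Qed.

Lemma column_filling_weight k : (k < m)%N ->
  Posz (addn (column_filling Phi F (2 * k).+3) (column_filling Phi F (2 * k).+4)) =
    weight (f' k.+1) + weight (f k.+1) - weight (f' k) - weight (f k.+2).
Proof.
move=> km; have [_ pf sf] := vf.
have [[_ sk /(_ _ _ mP)[ra rb]] /(_ km)[_ /(_ _ _ mP) bk]] := vac_promotion_rows (ltnW km).
have [ra3 ra4 rb3 rb4] := embed_rows bk ra rb.
have sn : vac_step (f k.+1) (f k.+2) by apply: sf; lia.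
rewrite -(fills_block fills_mid sk sn bk) /column_filling /= -/F in ra ra3 ra4 rb rb3 rb4 *.
have -> : F (2 * k).+2 = f k.+1 *+ 2 by rewrite /F -(embed_even mid) mulnS.
have -> : F (2 * k).+3 = mid (f k.+1) (f k.+2) by rewrite /F -embed_odd mulnS.
have -> : F (2 * k).+4 = f k.+2 *+ 2 by rewrite /F -(embed_even mid) !mulnS.
by rewrite ra ra3 ra4 rb rb3.
Qed.

End Step.

(** [slide] starts with 0 one column before [row_a] starts with its first value; this equation makes
    them agree in that next column. *)
Lemma embed_O_first m f (F := embed (@mid_O r) f) : vac_path m.+1 f ->
  dom (F 2%N - F 1%N) = F 1%N.
Proof.
move=> vf; have [a f1] := vac_path_first vf; have [f0 pf _] := vf.
have p1 : is_partition (e a) by rewrite -f1 pf.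
rewrite /F (embed_odd (@mid_O r) f 0) (embed_even (@mid_O r) f 1) f0 f1.
by rewrite -{2 3}[e a]add0r mid_O_up mul0rn add0r; apply: dom_eq => //; veq.
Qed.

End Promotion.

(** * Injectivity *)

Section Injectivity.
Variables (r n : nat) (l : 'I_r).
Hypothesis l_last : l.+1 = r.
Implicit Types (f g : nat -> 'rV[int]_r) (c d h i j k m : nat).
Local Notation e := (@unit_vec r).
Local Notation prom := (@vac_promotion r).
Local Notation O := (@mid_O r).

Lemma vac_path_iter f i : vac_path n f -> (i <= n)%N -> vac_path (n - i) (iter i prom f).
Proof.
move=> vf; elim: i => [|i IHi] hi /=; first by rewrite subn0.
by apply: (vac_path_promotion l_last); rewrite -subSn // subSS; apply: IHi; lia.
Qed.

Lemma vac_path_iterS f i : vac_path n f -> (i < n)%N ->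
  vac_path (n - i.+1).+1 (iter i prom f).
Proof. by move=> vf hi; rewrite -subSn // subSS; apply: vac_path_iter => //; lia. Qed.

Lemma iter_promotion mid Phi f i d : embedding mid Phi -> vac_path n f -> (i <= n)%N ->
  (d <= 2 * (n - i))%N ->
  iter i (promotion n) (embed mid f) d = embed mid (iter i prom f) d.
Proof.
move=> mP vf; elim: i d => [|i IHi] d hi hd //=.
rewrite /promotion ifT; last by lia.
rewrite (row_b_eq (nu := embed mid (iter i prom f))) //; last first.
  by move=> d' hd'; apply: IHi; lia.
exact: (row_b_embed l_last (vac_path_iterS vf hi) mP hd).
Qed.

(** The two sides of the congruence differ by less than n, so they are equal. *)
Lemma sum_congruent (F : nat -> nat) i j : (i < j)%N -> (j < n)%N ->
  (\sum_(2 <= k < n.+1 | j.+1 == i.+1 + k - 1 %[mod n]) F k)%N = F (j - i).+1.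
Proof.
move=> ij jn; rewrite (eq_bigl (fun k => j.+1 == i + k %[mod n])); last first.
  by move=> k; rewrite addSn subn1.
rewrite big_nat_cond (eq_bigl (fun k => k == (j - i).+1)); last first.
  move=> k; apply/idP/eqP => [/andP[hk]|->]; last first.
    have -> : (i + (j - i).+1 = j.+1)%N by lia.
    by rewrite eqxx andbT; lia.
  have [le|lt] := leqP (i + k) j.+1.
    rewrite eqn_mod_dvd // => dv; have [|pos] := posnP (j.+1 - (i + k)); first by lia.
    by have := dvdn_leq pos dv; lia.
  rewrite eq_sym eqn_mod_dvd; last by lia.
  move=> dv; have pos : (0 < i + k - j.+1)%N by lia.
  by have := dvdn_leq pos dv; lia.
by rewrite big_nat1_eq ifT //; lia.
Qed.

Lemma filling_matrixE mid Phi f (i j : 'I_n) : embedding mid Phi -> vac_path n f ->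
  (i < j)%N ->
  let k := (j - i.+1)%N in let q i k := weight (iter i prom f k) in
  Posz (filling_matrix Phi n (embed mid f) i j) =
    q i.+1 k.+1 + q i k.+1 - q i.+1 k - q i k.+2.
Proof.
move=> mP vf ij k q; have jn := ltn_ord j; have iN := ltn_ord i.
rewrite mxE -val_eqE /= ifF; last by lia.
rewrite sum_congruent //.
have -> : (2 * (j - i).+1 - 1 = (2 * k).+3)%N by rewrite /k; lia.
have -> : (2 * (j - i).+1 = (2 * k).+4)%N by rewrite /k; lia.
have eqF c : (1 < c <= (2 * k).+4)%N ->
  column_filling Phi (iter i (promotion n) (embed mid f)) c =
  column_filling Phi (embed mid (iter i prom f)) c.
  move=> hc; apply: column_filling_eq => [|d dc]; first by lia.
  by apply: (iter_promotion mP vf); rewrite /k in hc *; lia.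
rewrite !eqF; try lia.
by rewrite (column_filling_weight l_last (vac_path_iterS vf iN) mP) //; rewrite /k; lia.
Qed.

(** Induction on k: the sizes for k = 0 and k = 1 are always 0 and 1, and a matrix entry yields the
    size for k + 2 from three sizes with smaller k. *)
Lemma weight_iter f g mid Phi : embedding mid Phi -> vac_path n f -> vac_path n g ->
  filling_matrix Phi n (embed mid f) = filling_matrix Phi n (embed mid g) ->
  forall k i, (i + k <= n)%N -> weight (iter i prom f k) = weight (iter i prom g k).
Proof.
move=> mP vf vg eM; elim/ltn_ind => -[|[|k]] IHk i ik.
- have [|-> _ _] := vac_path_iter (i := i) vf; first by lia.
  by have [|-> _ _] := vac_path_iter (i := i) vg; first by lia.
- have [|a ->] := vac_path_first l_last (vac_path_iterS (i := i) vf _); first by lia.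
  have [|b ->] := vac_path_first l_last (vac_path_iterS (i := i) vg _); first by lia.
  by rewrite !weight_unit.
have iN : (i < n)%N by lia.
have jN : (i + k.+1 < n)%N by lia.
have ij : (Ordinal iN < Ordinal jN)%N by rewrite /=; lia.
have := filling_matrixE mP vf ij; rewrite eM (filling_matrixE mP vg ij) /=.
have -> : (i + k.+1 - i.+1 = k)%N by lia.
have := IHk k.+1 _ i.+1; have := IHk k.+1 _ i; have := IHk k _ i.+1; rewrite /=.
by do 3!(move=> ->; try lia); lia.
Qed.

(** Step i + 1 of promotion fills rows 2i+1 and 2i+2 of the growth diagram, with columns shifted by
    2i; this is the first of the two. *)
Lemma rows_odd f i d (R := rows (embed O f) (2 * i)) : vac_path n f -> (i < n)%N ->
  (forall d, (d <= 2 * (n - i))%N -> R (2 * i + d)%N = embed O (iter i prom f) d) ->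
  (2 <= d <= 2 * (n - i))%N ->
  slide (2 * i) R (2 * i + d) = row_a (embed O (iter i prom f)) d.
Proof.
move=> vf hi RE; elim: d => [|[|[|d]] IHd] // hd.
  rewrite addn2 slideS ?slide0 //; try lia.
  rewrite add0r -addn2 -[(2 * i).+1]addn1 !RE; try lia.
  by rewrite (embed_O_first l_last (vac_path_iterS vf hi)).
rewrite addnS slideS; last by lia.
by rewrite IHd -?addnS ?RE; try lia.
Qed.

Lemma rows_even f i d : vac_path n f -> (i <= n)%N -> (d <= 2 * (n - i))%N ->
  rows (embed O f) (2 * i) (2 * i + d) = embed O (iter i prom f) d.
Proof.
move=> vf; elim: i d => [|i IHi] d hi hd //.
set R := rows (embed O f) (2 * i).
have RE d' : (d' <= 2 * (n - i))%N -> R (2 * i + d')%N = embed O (iter i prom f) d'.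
  by move=> hd'; apply: IHi => //; lia.
have eO : embedding O (@Phi_O r) by left.
have -> : (2 * i.+1 + d = 2 * i + d.+2)%N by lia.
rewrite mulnS [rows _ _]/= -/R -(row_b_embed l_last (vac_path_iterS vf hi) eO hd).
elim: d hd => [|d IHd] hd.
  by rewrite slide0 // addn2.
rewrite addnS slideS; last by lia.
rewrite IHd; last by lia.
by rewrite -addnS !(rows_odd vf hi RE) //; lia.
Qed.

(** Even rows are embedded paths, with sizes controlled by [weight_mid_O]. Odd rows alternate
    between values of [mid_O] and centres of blocks; a centre comes from a vector without negative
    entries, so its size is linear in its neighbours. *)
Lemma weight_rows f g : vac_path n f -> vac_path n g ->
  (forall k i, (i + k <= n)%N -> weight (iter i prom f k) = weight (iter i prom g k)) ->
  forall h c, (h <= c <= 2 * n)%N ->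
  weight (rows (embed O f) h c) = weight (rows (embed O g) h c).
Proof.
move=> vf vg wE h c /andP[hc cN].
have eO : embedding O (@Phi_O r) by left.
pose i := h./2; pose d := (c - 2 * i)%N.
have [odd_h|even_h] := boolP (odd h); last first.
  have -> : h = (2 * i)%N by rewrite /i; lia.
  have -> : c = (2 * i + d)%N by rewrite /d /i; lia.
  rewrite !rows_even //; try by rewrite /i /d; lia.
  have [odd_d|even_d] := boolP (odd d); last first.
    have -> : d = (2 * d./2)%N by lia.
    by rewrite !embed_even !weight_double wE // /i /d; lia.
  have -> : d = (2 * d./2).+1%N by lia.
  have hi : (i <= n)%N by rewrite /i; lia.
  have [_ _ sf] := vac_path_iter vf hi; have [_ _ sg] := vac_path_iter vg hi.
  rewrite !embed_odd.
  apply: (weight_mid_O l_last); [apply: sf|apply: sg|apply: wE|apply: wE]; rewrite /i /d; lia.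
have hi : (i < n)%N by rewrite /i; lia.
have -> : h = (2 * i).+1%N by rewrite /i; lia.
have [d2|d1] := ltnP 1 d; last first.
  by rewrite /= !slide0 //; move: d1; rewrite /d /i; lia.
have -> : c = (2 * i + d)%N by rewrite /d /i; lia.
have dN : (d <= 2 * (n - i))%N by rewrite /d /i; lia.
have REf d' := @rows_even f i d' vf (ltnW hi); have REg d' := @rows_even g i d' vg (ltnW hi).
rewrite /= (rows_odd vf hi REf) ?(rows_odd vg hi REg) ?d2 //.
have vf' := vac_path_iterS vf hi; have vg' := vac_path_iterS vg hi.
have [_ _ sf] := vf'; have [_ _ sg] := vg'.
have [odd_d|even_d] := boolP (odd d).
  pose k := (d - 3)./2; have -> : d = (2 * k).+3%N by rewrite /k; lia.
  have km : (k < n - i.+1)%N by rewrite /k; lia.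
  have w1 : weight (iter i prom f k.+1) = weight (iter i prom g k.+1) by apply: wE; lia.
  have w2 : weight (iter i prom f k.+2) = weight (iter i prom g k.+2) by apply: wE; lia.
  have w3 : weight (iter i.+1 prom f k) = weight (iter i.+1 prom g k) by apply: wE; lia.
  have kf := row_a_step l_last vf' (ltnW km); have kg := row_a_step l_last vg' (ltnW km).
  rewrite (row_a_odd l_last vf' eO km) (row_a_odd l_last vg' eO km) !weight_double w1.
  by rewrite (weight_mid_O l_last kf kg w1 w3) (weight_mid_O l_last (sf k.+1 km) (sg k.+1 km) w1 w2).
pose k := (d - 2)./2; have -> : d = (2 * k).+2%N by rewrite /k; lia.
have km : (k <= n - i.+1)%N by rewrite /k; lia.
rewrite (row_a_even l_last vf' eO km) (row_a_even l_last vg' eO km).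
have kf := row_a_step l_last vf' km; have kg := row_a_step l_last vg' km.
by apply: (weight_mid_O l_last kf kg); [apply: wE|apply: (wE _ i.+1)]; lia.
Qed.

Lemma box_path_embed f : vac_path n f -> box_path (2 * n) 0 (embed O f).
Proof.
move=> [f0 pf sf]; split=> [|c hc|c hc].
- by rewrite (embed_even O f 0) f0 mul0rn.
- have [odd_c|even_c] := boolP (odd c); last first.
    have -> : c = (2 * c./2)%N by lia.
    rewrite embed_even; have p := pf c./2; have {}p : is_partition (f c./2) by apply: p; lia.
    ppart.
  have -> : c = (2 * c./2).+1%N by lia.
  have s : vac_step (f c./2) (f c./2.+1) by apply: sf; lia.
  have p : is_partition (f c./2) by apply: pf; lia.
  have q : is_partition (f c./2.+1) by apply: pf; lia.
  rewrite embed_odd; move: p q; case: s => [[a ->]|[a ->]|[<- pos]] p q.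
  + by rewrite midE; ppart.
  + by rewrite midE; ppart.
  + by rewrite midE (last_unitE l_last); ppart.
have s k : (k < n)%N -> box_step (f k *+ 2) (O (f k) (f k.+1)) /\
    box_step (O (f k) (f k.+1)) (f k.+1 *+ 2).
  move=> /sf[[a ->]|[a ->]|[<- _]]; rewrite midE ?(last_unitE l_last).
  - by split; constructor 2; exists a => //; veq.
  - by split; constructor 3; exists a; veq.
  - by split; [constructor 3|constructor 2]; exists l => //; veq.
have [odd_c|even_c] := boolP (odd c).
  have -> : c = (2 * c./2).+1%N by lia.
  rewrite embed_odd; have -> : (2 * c./2).+2 = (2 * c./2.+1)%N by lia.
  by rewrite embed_even; apply: (s _ _).2; lia.
have -> : c = (2 * c./2)%N by lia.
by rewrite embed_odd embed_even; apply: (s _ _).1; lia.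
Qed.

(** Either matrix determines the sizes in the growth diagram for O, so the reconstruction is applied
    to the embedding in O in both cases. *)
Lemma embed_inj mid Phi f g : embedding mid Phi -> vac_path n f -> vac_path n g ->
  f n = 0 -> g n = 0 ->
  filling_matrix Phi n (embed mid f) = filling_matrix Phi n (embed mid g) ->
  forall k, (k <= n)%N -> f k = g k.
Proof.
move=> mP vf vg fn gn eM k kn.
have wE := weight_rows vf vg (weight_iter mP vf vg eM).
have := rows_weight_inj (box_path_embed vf) (box_path_embed vg) _ _ wE.
rewrite !embed_even fn gn mul0rn => /(_ erefl erefl (2 * k)%N).
by rewrite !embed_even => eqk; rewrite -[LHS]halfv_double eqk ?halfv_double //; lia.
Qed.

Lemma vac_path_tableau (V : n.+1.-tuple 'rV[int]_r) : vacillating_tableau V ->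
  vac_path n (nth 0 V) /\ nth 0 V n = 0.
Proof.
case/and4P=> /eqP V0 /eqP Vn /allP pV /forallP sV; split=> //; split=> // k kn.
  by apply: pV; apply: mem_nth; rewrite size_tuple.
have := sV (Ordinal kn); rewrite /vacillating_step /=.
case/or3P=> [/existsP[a /eqP->]|/existsP[a /eqP->]|/andP[/eqP<- /forallP pos]].
- by constructor 1; exists a.
- by constructor 2; exists a.
- by constructor 3.
Qed.

Lemma tableau_inj mid Phi (V W : n.+1.-tuple 'rV[int]_r) : embedding mid Phi ->
  vacillating_tableau V -> vacillating_tableau W ->
  filling_matrix Phi n (embed mid (nth 0 V)) = filling_matrix Phi n (embed mid (nth 0 W)) ->
  V = W.
Proof.
move=> mP /vac_path_tableau[vV Vn] /vac_path_tableau[vW Wn] eM.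
apply/val_inj/(@eq_from_nth _ 0); rewrite !size_tuple // => k kn.
exact: (embed_inj mP vV vW Vn Wn eM).
Qed.

End Injectivity.

Theorem corollary4p12 (r n : nat) (hr : (0 < r)%N) (hn : (0 < n)%N) :
  {in @vacillating_tableau r n &, injective (@M_VO r n)} /\
  {in @vacillating_tableau r n &, injective (@M_VF r n)}.
Proof.
have [l l_last] : exists l : 'I_r, l.+1 = r.
  by case: r hr => // r' _; exists ord_max.
have eO : embedding (@mid_O r) (@Phi_O r) by left.
have eF : embedding (@mid_F r) (@Phi_F r) by right.
by split=> V W tV tW eM; [apply: (tableau_inj l_last eO)|apply: (tableau_inj l_last eF)].
Qed.
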